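(* Let $E_1,\ldots,E_m,F$ be Riesz spaces with $F$ Archimedean and let $A\colon E_1\times\cdots\times E_m\to F$ be a regular $m$-linear operator of finite lattice rank. If $A$ is disjointness preserving, then all Arens extensions $AR_m^\rho(A)\colon E_1^{\sim\sim}\times\cdots\times E_m^{\sim\sim}\to F^{\sim\sim}$ of $A$, $\rho\in S_m$, are disjointness preserving.
   Context: Riesz spaces are real and not assumed Archimedean unless stated. $E^\sim$ is the order dual of a Riesz space $E$ and $E^{\sim\sim}=(E^\sim)^\sim$. $S_m$ is the set of permutations of $\{1,\ldots,m\}$. Vectors $x,y$ are disjoint, $x\perp y$, if $|x|\wedge|y|=0$. A map taking values in a Riesz space has finite lattice rank if the (vector) sublattice generated by its range is finite dimensional. An $m$-linear operator between Riesz spaces is positive if it takes positive values at $m$-tuples of positive vectors, and regular if it is a difference of two positive $m$-linear operators; $\mathcal L_r(E_1,\ldots,E_m)$ is the space of regular $m$-linear forms. Regular operators are order bounded (they send order bounded sets, for the coordinatewise order, to order bounded sets). An order bounded $m$-linear operator is disjointness preserving if it is so separately: for every $j$ and all fixed $x_i\in E_i$, $i\ne j$, the linear operator $x_j\mapsto A(x_1,\ldots,x_m)$ sends disjoint vectors to disjoint vectors. Arens extensions: let $\rho\in S_m$. For $i=1,\ldots,m-1$ and $x_{\rho(i)}^{\sim\sim}\in E_{\rho(i)}^{\sim\sim}$ define $\overline{x_{\rho(i)}^{\sim\sim}}\colon\mathcal L_r(E_{\rho(i)},\ldots,E_{\rho(m)})\to\mathcal L_r(E_{\rho(i+1)},\ldots,E_{\rho(m)})$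 by $\overline{x_{\rho(i)}^{\sim\sim}}(B)=x_{\rho(i)}^{\sim\sim}\circ B^i$, where $B^i\colon E_{\rho(i+1)}\times\cdots\times E_{\rho(m)}\to E_{\rho(i)}^\sim$, $B^i(x_{i+1},\ldots,x_m)(x_i)=B(x_i,x_{i+1},\ldots,x_m)$ for $x_k\in E_{\rho(k)}$; for $i=m$ put $\overline{x_{\rho(m)}^{\sim\sim}}=x_{\rho(m)}^{\sim\sim}\colon E_{\rho(m)}^\sim\to\mathbb R$. For an $m$-linear form $C$ on $E_1\times\cdots\times E_m$ let $C_\rho\colon E_{\rho(1)}\times\cdots\times E_{\rho(m)}\to\mathbb R$, $C_\rho(x_1,\ldots,x_m)=C(x_{\rho^{-1}(1)},\ldots,x_{\rho^{-1}(m)})$. The Arens extension of a regular $m$-linear operator $A\colon E_1\times\cdots\times E_m\to F$ with respect to $\rho$ is the (regular) $m$-linear operator $AR_m^\rho(A)\colon E_1^{\sim\sim}\times\cdots\times E_m^{\sim\sim}\to F^{\sim\sim}$, $$AR_m^\rho(A)(x_1^{\sim\sim},\ldots,x_m^{\sim\sim})(y^\sim)=\big(\overline{x_{\rho(m)}^{\sim\sim}}\circ\cdots\circ\overline{x_{\rho(1)}^{\sim\sim}}\big)((y^\sim\circ A)_\rho),\quad y^\sim\in F^\sim.$$ *)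

(* Defs.v *)
From HB Require Import structures.
From mathcomp Require Import all_boot all_order all_fingroup all_algebra.
From mathcomp Require Import boolp classical_sets functions reals.

Set Implicit Arguments.
Unset Strict Implicit.
Unset Printing Implicit Defensive.

Import Order.TTheory GRing.Theory Num.Theory.
Local Open Scope classical_set_scope.
Local Open Scope ring_scope.

(* The order library's lattice structures cannot be joined with Lmodule
   outside mathcomp (numDomainType is already below both), so a Riesz space is
   a partially ordered vector space with explicit binary joins and meets. *)
HB.mixin Record POrderedLmodule_isRiesz (R : realType) E
    of Num.POrderedZmodule E & GRing.Lmodule R E := {
  riesz_leD2r_subproof : forall x y z : E, x <= y -> x + z <= y + z;
  riesz_scale_ge0 : forall (a : R) (x : E), 0 <= a -> 0 <= x -> 0 <= a *: x;
  rjoin : E -> E -> E;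
  rmeet : E -> E -> E;
  rleUx : forall x y z : E, (rjoin x y <= z) = (x <= z) && (y <= z);
  rlexI : forall x y z : E, (z <= rmeet x y) = (z <= x) && (z <= y)
}.

#[short(type="rieszType")]
HB.structure Definition Riesz (R : realType) :=
  { E of Num.POrderedZmodule E & GRing.Lmodule R E
       & POrderedLmodule_isRiesz R E }.

HB.instance Definition _ (R : realType) := Order.POrder.copy R^o R.

Section RealRiesz.
Variable R : realType.

Fact real_leD2r (x y z : R^o) : x <= y -> x + z <= y + z.
Proof. by move=> xy; exact: (@lerD R _ _ _ _ xy (lexx _)). Qed.

Fact real_scale_ge0 (a : R) (x : R^o) : 0 <= a -> 0 <= x -> 0 <= a *: x.
Proof. exact: (@mulr_ge0 R). Qed.

Fact real_leUx (x y z : R^o) :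
  (Num.max (x : R) (y : R) <= (z : R)) = (x <= z) && (y <= z).
Proof. exact: ge_max. Qed.

Fact real_lexI (x y z : R^o) :
  ((z : R) <= Num.min (x : R) (y : R)) = (z <= x) && (z <= y).
Proof. exact: le_min. Qed.

HB.instance Definition _ := POrderedLmodule_isRiesz.Build R R^o
  real_leD2r real_scale_ge0 real_leUx real_lexI.

End RealRiesz.

Definition rabs (R : realType) (E : rieszType R) (x : E) : E :=
  rjoin x (- x).

Definition disjoint_vec (R : realType) (E : rieszType R) (x y : E) : Prop :=
  rmeet (rabs x) (rabs y) = 0.

Definition archimedean_riesz (R : realType) (E : rieszType R) : Prop :=
  forall x y : E, 0 <= x -> (forall n : nat, x *+ n <= y) -> x = 0.

Section RieszTheory.
Context {R : realType} {E : rieszType R}.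
Implicit Types x y z u v : E.

Lemma riesz_leD2r z x y : (x + z <= y + z) = (x <= y).
Proof.
apply/idP/idP; last exact: riesz_leD2r_subproof.
by move/(@riesz_leD2r_subproof R E _ _ (- z)); rewrite !addrK.
Qed.

Lemma riesz_leD x y u v : x <= y -> u <= v -> x + u <= y + v.
Proof.
move=> xy uv; apply: (@le_trans _ _ (y + u)); first by rewrite riesz_leD2r.
by rewrite ![y + _]addrC riesz_leD2r.
Qed.

Lemma riesz_subr_ge0 x y : (0 <= y - x) = (x <= y).
Proof. by rewrite -(riesz_leD2r x 0) add0r subrK. Qed.

Lemma riesz_addr_ge0 x y : 0 <= x -> 0 <= y -> 0 <= x + y.
Proof. by move=> x0 y0; rewrite -[0]addr0; exact: riesz_leD. Qed.

Lemma rleUl x y : x <= rjoin x y.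
Proof. by have := lexx (rjoin x y); rewrite rleUx => /andP[]. Qed.
Lemma rleUr x y : y <= rjoin x y.
Proof. by have := lexx (rjoin x y); rewrite rleUx => /andP[]. Qed.
Lemma rleIl x y : rmeet x y <= x.
Proof. by have := lexx (rmeet x y); rewrite rlexI => /andP[]. Qed.
Lemma rleIr x y : rmeet x y <= y.
Proof. by have := lexx (rmeet x y); rewrite rlexI => /andP[]. Qed.

Definition rpos x : E := rjoin x 0.
Definition rneg x : E := rpos x - x.

Lemma rpos_ge0 x : 0 <= rpos x. Proof. by rewrite rleUr. Qed.
Lemma rneg_ge0 x : 0 <= rneg x. Proof. by rewrite riesz_subr_ge0 rleUl. Qed.
Lemma rposBneg x : x = rpos x - rneg x.
Proof. by rewrite opprB addrC subrK. Qed.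

Lemma rsplit x : exists u v, [/\ 0 <= u, 0 <= v & x = u - v].
Proof.
by exists (rpos x), (rneg x); split; [exact: rpos_ge0|exact: rneg_ge0|
  exact: rposBneg].
Qed.

Lemma riesz_decomp x y z : 0 <= x -> 0 <= y -> 0 <= z -> z <= x + y ->
  exists u v, [/\ z = u + v, 0 <= u, u <= x, 0 <= v & v <= y].
Proof.
move=> x0 y0 z0 zxy; exists (rmeet z x), (z - rmeet z x); split.
- by rewrite addrC subrK.
- by rewrite rlexI z0.
- exact: rleIr.
- by rewrite riesz_subr_ge0 rleIl.
rewrite -(riesz_leD2r (rmeet z x - y)) addrA subrK addrCA subrr addr0.
rewrite rlexI -(riesz_leD2r y) subrK.
rewrite -(riesz_leD2r y (z - y)) subrK zxy andbT.
by rewrite -[X in X <= _]addr0; apply: riesz_leD.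
Qed.

Lemma linear_diff (f : E -> R^o) : linear f -> forall x y, f (x - y) = f x - f y.
Proof. by move=> lf x y; rewrite addrC -scaleN1r lf scaleN1r addrC. Qed.

Lemma cone_extend (g : E -> R^o) :
  (forall x y, 0 <= x -> 0 <= y -> g (x + y) = g x + g y) ->
  (forall (a : R) x, 0 <= a -> 0 <= x -> g (a *: x) = a *: g x) ->
  linear (fun x => g (rpos x) - g (rneg x)) /\
  (forall x, 0 <= x -> g (rpos x) - g (rneg x) = g x).
Proof.
move=> gD gZ; pose h x : R^o := g (rpos x) - g (rneg x).
have hE u v : 0 <= u -> 0 <= v -> h (u - v) = g u - g v.
  move=> u0 v0; set x := u - v; have : g (rpos x) + g v = g u + g (rneg x).
    rewrite -!gD ?rpos_ge0 ?rneg_ge0//; congr g.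
    by rewrite /rneg; move: (rpos x) => p; rewrite /x opprB addrCA [u + _]addrC subrK.
  by move=> e; apply/eqP; rewrite subr_eq addrAC eq_sym subr_eq -e addrC.
have g0 : g 0 = 0 by rewrite -(scale0r (0 : E)) gZ// scale0r.
have hD x y : h (x + y) = h x + h y.
  have [u [v [u0 v0 ->]]] := rsplit x; have [s [t [s0 t0 ->]]] := rsplit y.
  by rewrite addrACA -opprD !hE ?riesz_addr_ge0// !gD// opprD addrACA.
have hZ (a : R) x : h (a *: x) = a *: h x.
  have [u [v [u0 v0 ->]]] := rsplit x; rewrite scalerBr.
  case: (leP 0 a) => a0.
    by rewrite !hE ?riesz_scale_ge0// !gZ// scalerBr.
  have Na0 : 0 <= - a by rewrite oppr_ge0 ltW.
  have -> : a *: u - a *: v = (- a) *: v - (- a) *: u.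
    by rewrite !scaleNr opprK addrC.
  by rewrite !hE ?riesz_scale_ge0// !gZ// !scaleNr scalerBr opprK addrC.
split=> [a x y|x x0]; first by rewrite -/(h _) hD hZ.
by rewrite -/(h x) -{1}(subr0 x) hE// g0 subr0.
Qed.

End RieszTheory.

Definition order_bounded (R : realType) (E F : rieszType R) (f : E -> F) :=
  forall a b : E, exists c d : F,
    forall x : E, a <= x -> x <= b -> c <= f x /\ f x <= d.

(* The order dual, with the Riesz-Kantorovich lattice structure. *)
Definition odual_pred (R : realType) (E : rieszType R) : {pred E -> R^o} :=
  fun f => `[< linear f /\ order_bounded f >].

Record odual (R : realType) (E : rieszType R) := ODual {
  odual_fun :> E -> R^o;
  odualP : odual_fun \in @odual_pred R E
}.

Section OrderDual.
Context {R : realType} {E : rieszType R}.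

HB.instance Definition _ := [isSub of odual E for @odual_fun R E].
HB.instance Definition _ := [Choice of odual E by <:].

Lemma odual_predP (f : E -> R^o) :
  reflect (linear f /\ order_bounded f) (f \in @odual_pred R E).
Proof. exact: asboolP. Qed.

Fact odual_submod_closed : submod_closed (@odual_pred R E).
Proof.
split=> [|a f g /odual_predP[lf bf] /odual_predP[lg bg]]; apply/odual_predP.
  split=> [k x y|x y]; first by rewrite -[RHS]/(k *: 0 + 0 : R^o) scaler0 addr0.
  by exists 0, 0 => z _ _; rewrite lexx.
have E1 z : (a *: f + g) z = a *: f z + g z by [].
split=> [k x y|x y].
  rewrite !E1 lf lg !scalerDr !scalerA mulrC -!addrA; congr (_ + _).
  by rewrite addrCA.
have [c1 [d1 h1]] := bf x y; have [c2 [d2 h2]] := bg x y.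
case: (leP 0 a) => a0.
  exists (a *: c1 + c2), (a *: d1 + d2) => z xz zy.
  have [? ?] := h1 _ xz zy; have [? ?] := h2 _ xz zy; rewrite !E1.
  by split; apply: lerD => //; apply: (@ler_wpM2l R).
exists (a *: d1 + c2), (a *: c1 + d2) => z xz zy.
have [? ?] := h1 _ xz zy; have [? ?] := h2 _ xz zy; rewrite !E1.
by split; apply: lerD => //; apply: (@ler_wnM2l R) => //; exact: ltW.
Qed.

HB.instance Definition _ :=
  GRing.isSubmodClosed.Build R (E -> R^o) (@odual_pred R E) odual_submod_closed.
HB.instance Definition _ := [SubChoice_isSubLmodule of odual E by <:].

Lemma odual_pred_sub (f g : E -> R^o) :
  f \in @odual_pred R E -> g \in @odual_pred R E ->
  (fun u => f u - g u) \in @odual_pred R E.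
Proof. exact: (@rpredB _ (@odual_pred R E)). Qed.

Implicit Types f g h : odual E.

Lemma odual_linear f : linear f.
Proof. by have /odual_predP[] := odualP f. Qed.

Lemma odual_bounded f : order_bounded f.
Proof. by have /odual_predP[] := odualP f. Qed.

Lemma odualD f g x : (f + g) x = f x + g x. Proof. by []. Qed.
Lemma odualN f x : (- f) x = - f x. Proof. by []. Qed.
Lemma odualZ (a : R) f x : (a *: f) x = a *: f x. Proof. by []. Qed.
Lemma odual_addr f x y : f (x + y) = f x + f y.
Proof. by have := odual_linear f 1 x y; rewrite !scale1r. Qed.
Lemma odual_scale f (a : R) x : f (a *: x) = a *: f x.
Proof.
have f0 : f 0 = 0 by rewrite -(subrr 0) (linear_diff (odual_linear f)) subrr.
by have := odual_linear f a x 0; rewrite f0 !addr0.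
Qed.
Lemma odual_subr f x y : f (x - y) = f x - f y.
Proof. exact: (linear_diff (odual_linear f)). Qed.

Lemma odual_eq f g : f =1 g -> f = g.
Proof. by move=> fg; apply/val_inj/funext. Qed.

Definition odual_le : rel (odual E) :=
  fun f g => `[< forall x : E, 0 <= x -> f x <= g x >].

Fact odual_le_refl : reflexive odual_le.
Proof. by move=> f; apply/asboolP => x _. Qed.

Fact odual_le_anti : antisymmetric odual_le.
Proof.
move=> f g /andP[/asboolP fg /asboolP gf]; apply: odual_eq => x.
have e (y : E) : 0 <= y -> f y = g y.
  by move=> y0; apply/eqP; rewrite eq_le fg// gf.
have [u [v [u0 v0 ->]]] := rsplit x.
by rewrite (odual_subr f) (odual_subr g) !e.
Qed.

Fact odual_le_trans : transitive odual_le.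
Proof.
move=> g f h /asboolP fg /asboolP gh; apply/asboolP => x x0.
exact: le_trans (fg _ x0) (gh _ x0).
Qed.

HB.instance Definition _ := Order.Le_isPOrder.Build ring_display (odual E)
  odual_le_refl odual_le_anti odual_le_trans.

Lemma odual_leP f g : reflect (forall x : E, 0 <= x -> f x <= g x) (f <= g).
Proof. exact: asboolP. Qed.

Lemma positive_odual_pred (f : E -> R^o) :
  linear f -> (forall x, 0 <= x -> 0 <= f x) -> f \in @odual_pred R E.
Proof.
move=> lf f0; apply/odual_predP; split=> // a b; exists (f a), (f b) => x ax xb.
have mono u v : u <= v -> f u <= f v.
  move=> uv; have := f0 (v - u); rewrite riesz_subr_ge0 (linear_diff lf).
  by rewrite riesz_subr_ge0; apply.
by rewrite !mono.
Qed.

Definition rk_set f (x : E) : set R := [set (f y : R) | y in [set y | 0 <= y <= x]].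
Definition rk_sup f (x : E) : R^o := sup (rk_set f x).

Lemma rk_has_sup f x : 0 <= x -> has_sup (rk_set f x).
Proof.
move=> x0; split; first by exists (f 0); exists 0 => //=; rewrite lexx.
have [c [d h]] := odual_bounded f 0 x.
by exists d => _ [y /andP[y0 yx] <-]; have [] := h _ y0 yx.
Qed.

Lemma rk_ub f x y : 0 <= y -> y <= x -> (f y : R) <= rk_sup f x.
Proof.
move=> y0 yx; have x0 := le_trans y0 yx.
apply: sup_upper_bound; first exact: rk_has_sup.
by exists y => //=; rewrite y0.
Qed.

Lemma rk_le f x (c : R) : 0 <= x ->
  (forall y, 0 <= y -> y <= x -> (f y : R) <= c) -> rk_sup f x <= c.
Proof.
move=> x0 h; apply: ge_sup; first by have [] := rk_has_sup f x0.
by move=> _ [y /andP[y0 yx] <-]; exact: h.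
Qed.

Lemma odual0 f : f 0 = 0.
Proof. by rewrite -(subrr 0) odual_subr subrr. Qed.

Lemma rk_supD f x y : 0 <= x -> 0 <= y -> rk_sup f (x + y) = rk_sup f x + rk_sup f y.
Proof.
move=> x0 y0; have xy0 := riesz_addr_ge0 x0 y0; apply/eqP; rewrite eq_le.
apply/andP; split.
  apply: rk_le => // z z0 zxy.
  have [u [v [-> u0 ux v0 vy]]] := riesz_decomp x0 y0 z0 zxy.
  by rewrite odual_addr; apply: lerD; exact: rk_ub.
rewrite -(@lerBrDr R); apply: rk_le => // u u0 ux.
rewrite lerBrDr addrC -(@lerBrDr R); apply: rk_le => // v v0 vy.
rewrite lerBrDr -odual_addr; apply: rk_ub; first exact: riesz_addr_ge0.
by rewrite addrC; exact: riesz_leD.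
Qed.

Lemma rk_supZ f (a : R) x : 0 <= a -> 0 <= x -> rk_sup f (a *: x) = a *: rk_sup f x.
Proof.
have le (b : R) y : 0 < b -> 0 <= y -> b *: rk_sup f y <= rk_sup f (b *: y).
  move=> b0 y0; rewrite -[leRHS](mulVKf (lt0r_neq0 b0)).
  apply: (@ler_wpM2l R); first exact: ltW.
  apply: rk_le => // u u0 uy; rewrite mulrC ler_pdivlMr// mulrC.
  rewrite -[_ * _]/(b *: f u) -odual_scale.
  apply: rk_ub; first by rewrite riesz_scale_ge0// ltW.
  rewrite -riesz_subr_ge0 -scalerBr riesz_scale_ge0 ?riesz_subr_ge0//.
  exact: ltW.
move=> a0 x0; move: a0; rewrite le_eqVlt => /predU1P[<-|a0].
  rewrite !scale0r; apply/eqP; rewrite eq_le; apply/andP; split.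
    apply: rk_le => // y y0 yx; suff -> : y = 0 by rewrite odual0.
    by apply/eqP; rewrite eq_le yx.
  by rewrite -(odual0 f); exact: rk_ub.
apply/eqP; rewrite eq_le le// andbT.
have ai : 0 < a^-1 by rewrite invr_gt0.
have := le _ (a *: x) ai; rewrite riesz_scale_ge0 ?(ltW a0)// => /(_ isT).
rewrite scalerA mulVf ?lt0r_neq0// scale1r => h.
have := @ler_wpM2l R _ (ltW a0) _ _ h.
by rewrite -[X in X <= _]/(a * (a^-1 * _)) mulVKf// lt0r_neq0.
Qed.

Definition rk_fun f (x : E) : R^o := rk_sup f (rpos x) - rk_sup f (rneg x).

Lemma rk_linear f : linear (rk_fun f).
Proof. by have [] := cone_extend (@rk_supD f) (@rk_supZ f). Qed.

Lemma rk_funE f x : 0 <= x -> rk_fun f x = rk_sup f x.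
Proof. by have [_] := cone_extend (@rk_supD f) (@rk_supZ f); apply. Qed.

Fact rk_fun_pred f : rk_fun f \in @odual_pred R E.
Proof.
apply: positive_odual_pred; first exact: rk_linear.
by move=> x x0; rewrite rk_funE// -(odual0 f); exact: rk_ub.
Qed.

Definition rk_pos f : odual E := ODual (rk_fun_pred f).

Lemma rk_posP f h : (rk_pos f <= h) = (0 <= h) && (f <= h).
Proof.
apply/odual_leP/andP => [H|[/odual_leP h0 /odual_leP fh] x x0].
  split; apply/odual_leP => x x0; apply: le_trans (H _ x0);
    rewrite /= rk_funE//; last exact: rk_ub.
  by rewrite -[leLHS](odual0 f); exact: rk_ub.
rewrite /= rk_funE//; apply: rk_le => // y y0 yx.
apply: (le_trans (fh _ y0)); rewrite -subr_ge0 -odual_subr.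
by apply: (h0); rewrite riesz_subr_ge0.
Qed.

Lemma odual_leD2r_subproof f g h : f <= g -> f + h <= g + h.
Proof.
move=> /odual_leP fg; apply/odual_leP => x x0.
by rewrite !odualD; apply: lerD => //; exact: fg.
Qed.

Lemma odual_leD2r h f g : (f + h <= g + h) = (f <= g).
Proof.
apply/idP/idP => [/(@odual_leD2r_subproof _ _ (- h))|].
  by rewrite !addrK.
exact: odual_leD2r_subproof.
Qed.

Lemma odual_leN f g : (- f <= - g) = (g <= f).
Proof. by rewrite -[LHS](odual_leD2r (f + g)) addKr addrCA addNr addr0. Qed.

Definition odual_join f g : odual E := rk_pos (f - g) + g.
Definition odual_meet f g : odual E := - odual_join (- f) (- g).

Fact odual_joinP f g h : (odual_join f g <= h) = (f <= h) && (g <= h).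
Proof.
rewrite -(odual_leD2r (- g)) addrK rk_posP odual_leD2r andbC.
by rewrite -(odual_leD2r g 0) add0r subrK.
Qed.

Fact odual_meetP f g h : (h <= odual_meet f g) = (h <= f) && (h <= g).
Proof. by rewrite -odual_leN opprK odual_joinP !odual_leN. Qed.

Fact odual_scale_ge0 (a : R) f : 0 <= a -> 0 <= f -> 0 <= a *: f.
Proof.
move=> a0 /odual_leP f0; apply/odual_leP => x x0.
by rewrite odualZ; apply: (@mulr_ge0 R) => //; exact: f0.
Qed.

HB.instance Definition _ := POrderedLmodule_isRiesz.Build R (odual E)
  odual_leD2r_subproof odual_scale_ge0 odual_joinP odual_meetP.

Lemma odual_ge0P f : (0 <= f) <-> (forall x : E, 0 <= x -> 0 <= f x).
Proof. by split=> [/odual_leP|h]; last exact/odual_leP. Qed.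

End OrderDual.

Definition bidual (R : realType) (E : rieszType R) : rieszType R :=
  odual (odual E : rieszType R).

Section RegularMultilinear.
Context {R : realType} {I : eqType} {E : I -> rieszType R} {F : rieszType R}.
Implicit Types (A P Q : (forall i, E i) -> F).

Definition multilinear A : Prop :=
  forall (x : forall i, E i) (j : I), linear (fun u : E j => A (dfwith x u)).

Definition positive_op A : Prop :=
  forall x : (forall i, E i), (forall i, 0 <= x i) -> 0 <= A x.

Definition regular_op A : Prop :=
  exists P Q, [/\ multilinear P, positive_op P, multilinear Q, positive_op Q
                & forall x, A x = P x - Q x].

Lemma multilinearD A P Q : multilinear P -> multilinear Q ->
  (forall x, A x = P x + Q x) -> multilinear A.
Proof.
move=> lP lQ AE x j k u v; rewrite !AE lP lQ scalerDr -!addrA.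
by congr (_ + _); rewrite addrCA.
Qed.

Lemma positive_opD A P Q : positive_op P -> positive_op Q ->
  (forall x, A x = P x + Q x) -> positive_op A.
Proof. by move=> P0 Q0 AE x x0; rewrite AE; apply: riesz_addr_ge0; auto. Qed.

End RegularMultilinear.

Lemma positive_generate (R : realType) (n : nat) (T : 'I_n -> rieszType R)
    (V : zmodType) (h : (forall i, T i) -> V) (S : V -> Prop) :
  (forall t j (u v : T j),
    h (dfwith t (u - v)) = h (dfwith t u) - h (dfwith t v)) ->
  (forall f g, S f -> S g -> S (f - g)) ->
  (forall t : (forall i, T i), (forall i, 0 <= t i) -> S (h t)) ->
  forall t, S (h t).
Proof.
move=> hB SB Sp.
have aux k : forall t : (forall i, T i),
    (forall i : 'I_n, (k <= i)%N -> 0 <= t i) -> S (h t).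
  elim: k => [|k IH] t t0; first by apply: Sp => i; apply: t0.
  case: (ltnP k n) => [kn|nk]; last first.
    apply: IH => i ki.
    by have := ltn_ord i; rewrite ltnNge (leq_trans nk ki).
  pose j := Ordinal kn; have [u [v [u0 v0 tj]]] := rsplit (t j).
  have tE : t = dfwith t (u - v).
    by apply: functional_extensionality_dep => i; case: dfwithP.
  have IHw (w : T j) : 0 <= w -> S (h (dfwith t w)).
    move=> w0; apply: IH => i ki; move: ki; case: dfwithP => // l jl kl.
    by apply: t0; rewrite ltn_neqAle kl andbT.
  by rewrite tE hB; apply: SB; apply: IHw.
by move=> t; apply: (aux n) => i; rewrite leqNgt ltn_ord.
Qed.

(* For I = 'I_m and F = R^o this is the space L_r(E_1, .., E_m). *)
Record regmlin (R : realType) (I : eqType) (E : I -> rieszType R)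
    (F : rieszType R) := RegMlin {
  regmlin_fun :> (forall i, E i) -> F;
  regmlinP : regular_op regmlin_fun
}.

Lemma positive_regular (R : realType) (I : eqType) (E : I -> rieszType R)
    (F : rieszType R) (P : (forall i, E i) -> F) :
  multilinear P -> positive_op P -> regular_op P.
Proof.
move=> lP P0; exists P, (fun=> 0); split=> // [x j a u v|x].
- by rewrite scaler0 addr0.
- by rewrite /= subr0.
Qed.

Section Arguments.
Variables (R : realType) (n : nat) (G : 'I_n.+1 -> rieszType R).

(* The tuple (u, t_1, .., t_n). *)
Definition dcons (u : G ord0) (t : forall i : 'I_n, G (lift ord0 i)) :
    forall i, G i := fun i =>
  match unliftP ord0 i with
  | UnliftSome j e => ecast k (G k) (esym e) (t j)
  | UnliftNone e => ecast k (G k) (esym e) u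
  end.

Lemma dcons0 u t : dcons u t ord0 = u.
Proof.
rewrite /dcons; case: unliftP => [j e|e]; last by rewrite eq_axiomK.
by case/negP: (neq_lift ord0 j); apply/eqP.
Qed.

Lemma dconsS u t i : dcons u t (lift ord0 i) = t i.
Proof.
rewrite /dcons; case: unliftP => [j e|e]; last first.
  by case/negP: (neq_lift ord0 i); apply/eqP.
by move: (e); have := lift_inj e => eij; subst j => {}e; rewrite eq_axiomK.
Qed.

Lemma eq_darg (x y : forall i, G i) :
  x ord0 = y ord0 -> (forall i, x (lift ord0 i) = y (lift ord0 i)) -> x = y.
Proof.
move=> e0 eS; apply: functional_extensionality_dep => i.
by case: (unliftP ord0 i) => [j|] ->.
Qed.

Lemma dcons_with0 u v t : dcons v t = dfwith (dcons u t) v.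
Proof.
apply: eq_darg => [|i]; first by rewrite dcons0 dfwith_in.
by rewrite dconsS dfwith_out ?dconsS// neq_lift.
Qed.

Lemma dcons_withS u t (i : 'I_n) (v : G (lift ord0 i)) :
  dcons u (dfwith t v) = dfwith (dcons u t) v.
Proof.
apply: eq_darg => [|k].
  by rewrite dcons0 dfwith_out ?dcons0// eq_sym neq_lift.
rewrite dconsS; case: dfwithP => [|j ij]; first by rewrite dfwith_in.
by rewrite dfwith_out ?dconsS// (inj_eq lift_inj).
Qed.

End Arguments.

Definition no_args (T : 'I_0 -> Type) : forall i, T i :=
  fun i => False_rect _ (notF (valP i)).

Section ArensStep.
Context {R : realType} {n : nat} {G : 'I_n.+1 -> rieszType R}.
Implicit Type B : regmlin G R^o.
Let tl (i : 'I_n) := G (lift ord0 i).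

Lemma slice_linear (P : (forall i, G i) -> R^o) (t : forall i, tl i) :
  multilinear P -> linear (fun u : G ord0 => P (dcons u t)).
Proof.
move=> lP a u v.
rewrite (dcons_with0 0 (a *: u + v)) (dcons_with0 0 u) (dcons_with0 0 v).
exact: lP.
Qed.

Lemma dcons_ge0 (u : G ord0) (t : forall i, tl i) :
  0 <= u -> (forall i, 0 <= t i) -> forall i, 0 <= dcons u t i.
Proof.
move=> u0 t0 i; case: (unliftP ord0 i) => [j|] ->.
  by rewrite dconsS; exact: t0.
by rewrite dcons0.
Qed.

Lemma slice_multilinear (P : (forall i, G i) -> R^o) (x : bidual (G ord0))
    (c : (forall i, tl i) -> odual (G ord0)) :
  multilinear P -> (forall t u, c t u = P (dcons u t)) ->
  multilinear (fun t => x (c t)).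
Proof.
move=> lP cE t j a u v; rewrite -odual_linear; congr (x _).
by apply: odual_eq => w; rewrite odualD odualZ !cE !dcons_withS lP.
Qed.

Lemma slice_pred (P : (forall i, G i) -> R^o) (t : forall i, tl i) :
  multilinear P -> positive_op P ->
  (fun u : G ord0 => P (dcons u t)) \in @odual_pred R (G ord0).
Proof.
move=> lP P0; move: t.
apply: (positive_generate (h := fun t u => P (dcons u t))
  (S := fun f : G ord0 -> R^o => f \in @odual_pred R (G ord0))).
- move=> t j u v; apply: funext => w.
  rewrite -[RHS]/(P (dcons w (dfwith t u)) - P (dcons w (dfwith t v))).
  by rewrite !dcons_withS (linear_diff (lP (dcons w t) (lift ord0 j))).
- by move=> f g; exact: odual_pred_sub.
move=> t t0; apply: positive_odual_pred; first exact: slice_linear.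
by move=> u u0; apply: P0; exact: dcons_ge0.
Qed.

Fact curry_pred B (t : forall i, tl i) :
  (fun u : G ord0 => B (dcons u t)) \in @odual_pred R (G ord0).
Proof.
have [P [Q [lP P0 lQ Q0 BE]]] := regmlinP B.
have -> : (fun u : G ord0 => B (dcons u t)) =
    (fun u => P (dcons u t) - Q (dcons u t)) by apply: funext => u; rewrite BE.
by apply: odual_pred_sub; exact: slice_pred.
Qed.

(* B^i(x_{i+1}, .., x_m) = B(-, x_{i+1}, .., x_m) *)
Definition curry B (t : forall i, tl i) : odual (G ord0) :=
  ODual (curry_pred B t).

Lemma curry_comb (a : R) B B1 B2 t : (forall x, B x = a *: B1 x + B2 x) ->
  curry B t = a *: curry B1 t + curry B2 t.
Proof. by move=> BE; apply: odual_eq => u; rewrite odualD odualZ /= BE. Qed.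

Lemma curry_multilinear B (x : bidual (G ord0)) :
  multilinear B -> multilinear (fun t => x (curry B t)).
Proof. by move=> lB; exact: (@slice_multilinear B x (curry B) lB). Qed.

Lemma curry_positive B (x : bidual (G ord0)) :
  0 <= x -> positive_op B -> positive_op (fun t => x (curry B t)).
Proof.
move=> /odual_ge0P x0 B0 t t0; apply: x0; apply/odual_ge0P => u u0 /=.
by apply: B0; exact: dcons_ge0.
Qed.

Fact arens_step_regular (x : bidual (G ord0)) B :
  regular_op (fun t : (forall i, tl i) => x (curry B t)).
Proof.
have [P [Q [lP P0 lQ Q0 BE]]] := regmlinP B.
pose P' := RegMlin (positive_regular lP P0).
pose Q' := RegMlin (positive_regular lQ Q0).
have [y [z [y0 z0 xE]]] := rsplit x.
exists (fun t => y (curry P' t) + z (curry Q' t)),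
  (fun t => z (curry P' t) + y (curry Q' t)); split.
- by apply: multilinearD (fun=> erefl); exact: curry_multilinear.
- by apply: positive_opD (fun=> erefl); exact: curry_positive.
- by apply: multilinearD (fun=> erefl); exact: curry_multilinear.
- by apply: positive_opD (fun=> erefl); exact: curry_positive.
move=> t; have cE : curry B t = curry P' t - curry Q' t.
  by apply: odual_eq => u; rewrite odualD odualN /= BE.
rewrite xE cE odualD odualN !odual_subr.
by rewrite opprB addrACA opprD [in RHS](addrC (- _)).
Qed.

(* The map denoted by an overlined x_{rho(i)}^{~~}, from
   L_r(E_{rho(i)}, .., E_{rho(m)}) to L_r(E_{rho(i+1)}, .., E_{rho(m)}). *)
Definition arens_step (x : bidual (G ord0)) B : regmlin tl R^o :=
  RegMlin (arens_step_regular x B).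

End ArensStep.

(* The composite of the maps arens_step along x_1, .., x_m; at the last
   variable the regular form on a single space is read as an element of its
   order dual. *)
Fixpoint arens_comp (R : realType) (n : nat) :
    forall G : 'I_n.+1 -> rieszType R,
      (forall i, bidual (G i)) -> regmlin G R^o -> R^o :=
  match n with
  | 0 => fun G x B => x ord0 (curry B (no_args _))
  | n'.+1 => fun G x B =>
      arens_comp (fun i => x (lift ord0 i)) (arens_step (x ord0) B)
  end.

Section ArensComp.
Context {R : realType}.

Definition form_linear (n : nat) (G : 'I_n -> rieszType R)
    (T : regmlin G R^o -> R^o) : Prop :=
  forall (a : R) (B B1 B2 : regmlin G R^o),
    (forall x, B x = a *: B1 x + B2 x) -> T B = a *: T B1 + T B2.

Definition form_positive (n : nat) (G : 'I_n -> rieszType R)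
    (T : regmlin G R^o -> R^o) : Prop :=
  forall B : regmlin G R^o, positive_op B -> 0 <= T B.

Lemma arens_comp_linear (n : nat) (G : 'I_n.+1 -> rieszType R)
  (x : forall i, bidual (G i)) : form_linear (arens_comp x).
Proof.
elim: n G x => [|n IH] G x a B B1 B2 BE /=.
  by rewrite (curry_comb _ BE) odual_linear.
by apply: IH => t /=; rewrite (curry_comb _ BE) odual_linear.
Qed.

Lemma arens_comp_positive (n : nat) (G : 'I_n.+1 -> rieszType R)
  (x : forall i, bidual (G i)) :
  (forall i, 0 <= x i) -> form_positive (arens_comp x).
Proof.
elim: n G x => [|n IH] G x x0 B B0 /=.
  by apply: (curry_positive (x0 ord0) B0); case.
by apply: IH => [i|]; [exact: x0|exact: curry_positive].
Qed.

Lemma arens_comp_multilinear (n : nat) (G : 'I_n.+1 -> rieszType R)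
  (B : regmlin G R^o) :
  multilinear (fun x : (forall i, bidual (G i)) => arens_comp x B).
Proof.
elim: n G B => [|n IH] G B x j a u v.
  by case: (unliftP ord0 j) u v => [[]//|->] u v /=; rewrite !dfwith_in.
case: (unliftP ord0 j) u v => [k|] -> u v /=; last first.
  have tlE (w : bidual (G ord0)) :
      (fun i : 'I_n.+1 => dfwith x w (lift ord0 i)) = (fun i => x (lift ord0 i)).
    by apply: functional_extensionality_dep => i; rewrite dfwith_out// neq_lift.
  by rewrite !tlE !dfwith_in; apply: arens_comp_linear.
have tlE (w : bidual (G (lift ord0 k))) :
    (fun i : 'I_n.+1 => dfwith x w (lift ord0 i)) =
    dfwith (fun i => x (lift ord0 i)) w.
  apply: functional_extensionality_dep => i; have [<-|ki] := eqVneq k i.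
    by rewrite !dfwith_in.
  by rewrite !dfwith_out// (inj_eq lift_inj).
have hdE (w : bidual (G (lift ord0 k))) : dfwith x w ord0 = x ord0.
  by rewrite dfwith_out// eq_sym neq_lift.
by rewrite !tlE !hdE; apply: IH.
Qed.

Lemma arens_comp_decomp (n : nat) (G : 'I_n.+1 -> rieszType R)
  (x : forall i, bidual (G i)) :
  exists P Q : regmlin G R^o -> R^o,
    [/\ form_linear P, form_positive P, form_linear Q, form_positive Q
      & forall B, arens_comp x B = P B - Q B].
Proof.
pose S (T : regmlin G R^o -> R^o) := exists P Q : regmlin G R^o -> R^o,
    [/\ form_linear P, form_positive P, form_linear Q, form_positive Q
      & forall B, T B = P B - Q B].
move: x; apply: (positive_generate (h := fun x B => arens_comp x B) (S := S)).
- move=> t j u v; apply: funext => B.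
  exact: (linear_diff (@arens_comp_multilinear n G B t j)).
- move=> f g [P [Q [lP P0 lQ Q0 fE]]] [P' [Q' [lP' P'0 lQ' Q'0 gE]]].
  have lD (T1 T2 : regmlin G R^o -> R^o) : form_linear T1 -> form_linear T2 ->
      form_linear (fun B => T1 B + T2 B).
    move=> l1 l2 a B B1 B2 BE; rewrite (l1 _ _ _ _ BE) (l2 _ _ _ _ BE).
    by rewrite scalerDr addrACA.
  have pD (T1 T2 : regmlin G R^o -> R^o) : form_positive T1 -> form_positive T2 ->
      form_positive (fun B => T1 B + T2 B).
    by move=> p1 p2 B B0; apply: riesz_addr_ge0; auto.
  exists (fun B => P B + Q' B), (fun B => P' B + Q B); split; auto.
  move=> B; rewrite -[LHS]/(f B - g B) fE gE.
  by rewrite opprB addrACA opprD [in RHS](addrC (- _)).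
move=> t t0; exists (arens_comp t), (fun=> 0); split=> //.
- exact: arens_comp_linear.
- exact: arens_comp_positive.
- by move=> a *; rewrite scaler0 addr0.
- by move=> B; rewrite subr0.
Qed.

End ArensComp.

(* C_rho(x_1, .., x_m) = C(x_{rho^-1(1)}, .., x_{rho^-1(m)}); the cast
   identifies E_{rho(rho^-1(j))} with E_j. *)
Definition unpermute (R : realType) (T : finType) (E : T -> rieszType R)
    (rho : {perm T})
    (x : forall i, E (rho i)) : forall j, E j :=
  fun j => ecast k (E k) (permKV rho j) (x ((rho^-1)%g j)).

Section Permute.
Context {R : realType} {T : finType} {E : T -> rieszType R} {F : rieszType R}.
Variable rho : {perm T}.
Local Notation Erho := (fun i : T => E (rho i)).

Lemma unpermute_at (x : forall i, E (rho i)) i :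
  unpermute x (rho i) = x i.
Proof.
rewrite /unpermute; move: (permKV rho (rho i)).
by rewrite permK => e; rewrite eq_axiomK.
Qed.

Lemma perm_split (j : T) : exists i, j = rho i.
Proof. by exists ((rho^-1)%g j); rewrite permKV. Qed.

Lemma unpermute_with (x : forall i, E (rho i)) i (u : E (rho i)) :
  unpermute (dfwith x u) = dfwith (unpermute x) (u : E (rho i)).
Proof.
apply: functional_extensionality_dep => j; have [k ->] := perm_split j.
rewrite unpermute_at; have [<-|ik] := eqVneq i k; first by rewrite !dfwith_in.
by rewrite !dfwith_out ?unpermute_at// (inj_eq perm_inj).
Qed.

Lemma permute_with (V : T -> rieszType R) (x : forall i, V i) i (u : V (rho i)) :
  (fun k => dfwith x u (rho k)) = dfwith (fun k => x (rho k)) u.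
Proof.
apply: functional_extensionality_dep => k.
have [<-|ik] := eqVneq i k; first by rewrite !dfwith_in.
by rewrite !dfwith_out// (inj_eq perm_inj).
Qed.

Lemma perm_multilinear (P : (forall i, E i) -> F) : multilinear P ->
  multilinear (fun x : (forall i, Erho i) => P (unpermute x)).
Proof. by move=> lP x j a u v; rewrite !unpermute_with lP. Qed.

Lemma perm_positive (P : (forall i, E i) -> F) : positive_op P ->
  positive_op (fun x : (forall i, Erho i) => P (unpermute x)).
Proof.
move=> P0 x x0; apply: P0 => j; have [k ->] := perm_split j.
by rewrite unpermute_at.
Qed.

Fact perm_regular (C : regmlin E F) :
  regular_op (fun x : (forall i, Erho i) => C (unpermute x)).
Proof.
have [P [Q [lP P0 lQ Q0 CE]]] := regmlinP C.
exists (fun x => P (unpermute x)), (fun x => Q (unpermute x)).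
by split=> //; [exact: perm_multilinear|exact: perm_positive|
  exact: perm_multilinear|exact: perm_positive].
Qed.

Definition perm_regmlin (C : regmlin E F) : regmlin Erho F :=
  RegMlin (perm_regular C).

End Permute.

Section DualComp.
Context {R : realType} {I : eqType} {E : I -> rieszType R} {F : rieszType R}.

Lemma odual_comp_multilinear (y : odual F) (A : (forall i, E i) -> F) :
  multilinear A -> multilinear (fun x => y (A x)).
Proof. by move=> lA x j a u v; rewrite lA odual_linear. Qed.

Lemma odual_comp_positive (y : odual F) (A : (forall i, E i) -> F) :
  0 <= y -> positive_op A -> positive_op (fun x => y (A x)).
Proof. by move=> /odual_ge0P y0 A0 x x0; exact/y0/A0. Qed.

Fact odual_comp_regular (y : odual F) (A : regmlin E F) :
  regular_op (fun x : (forall i, E i) => y (A x)).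
Proof.
have [P [Q [lP P0 lQ Q0 AE]]] := regmlinP A.
have [s [t [s0 t0 yE]]] := rsplit y.
exists (fun x => s (P x) + t (Q x)), (fun x => t (P x) + s (Q x)); split.
- by apply: multilinearD (fun=> erefl); exact: odual_comp_multilinear.
- by apply: positive_opD (fun=> erefl); exact: odual_comp_positive.
- by apply: multilinearD (fun=> erefl); exact: odual_comp_multilinear.
- by apply: positive_opD (fun=> erefl); exact: odual_comp_positive.
move=> x; rewrite AE yE odualD odualN !odual_subr.
by rewrite opprB addrACA opprD [in RHS](addrC (- _)).
Qed.

Definition odual_comp (y : odual F) (A : regmlin E F) : regmlin E R^o :=
  RegMlin (odual_comp_regular y A).

End DualComp.

(* The Arens extension AR_m^rho(A), as a regular m-linear operator between
   the biduals, with m = n.+1. *)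
Section ArensExtension.
Context {R : realType} {n : nat} {E : 'I_n.+1 -> rieszType R} {F : rieszType R}.
Variable rho : 'S_n.+1.
Implicit Types (A : regmlin E F) (x : forall i, bidual (E i)) (y : odual F).

Definition arens_val A x y : R^o :=
  arens_comp (fun i => x (rho i)) (perm_regmlin rho (odual_comp y A)).

Fact arens_val_pred A x : arens_val A x \in @odual_pred R (odual F).
Proof.
have [P [Q [lP P0 lQ Q0 TE]]] := arens_comp_decomp (fun i => x (rho i)).
have [A1 [A2 [lA1 A10 lA2 A20 AE]]] := regmlinP A.
pose B1 := RegMlin (positive_regular lA1 A10).
pose B2 := RegMlin (positive_regular lA2 A20).
pose f (U : regmlin (fun i => E (rho i)) R^o -> R^o) (B : regmlin E F) y : R^o :=
  U (perm_regmlin rho (odual_comp y B)).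
have fP U (B : regmlin E F) : form_linear U -> form_positive U -> positive_op B ->
    multilinear B -> f U B \in @odual_pred R (odual F).
  move=> lU U0 B0 lB; apply: positive_odual_pred => [a y z|y y0].
    by apply: lU => t.
  by apply: U0; apply: (perm_positive (P := odual_comp y B));
    exact: odual_comp_positive.
have -> : arens_val A x =
    (fun y => (fun y => f P B1 y - f P B2 y) y -
              (fun y => f Q B1 y - f Q B2 y) y).
  have fB U : form_linear U -> f U A = (fun y => f U B1 y - f U B2 y).
    move=> lU; apply: funext => y.
    have := lU (-1) (perm_regmlin rho (odual_comp y A))
      (perm_regmlin rho (odual_comp y B2)) (perm_regmlin rho (odual_comp y B1)).
    rewrite /f => ->; first by rewrite scaleN1r addrC.
    by move=> t /=; rewrite AE odual_subr scaleN1r addrC.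
  by apply: funext => y; rewrite /arens_val TE -/(f P A y) -/(f Q A y) !fB.
by apply: odual_pred_sub; apply: odual_pred_sub; exact: fP.
Qed.

Definition arens_fun A x : bidual F := ODual (arens_val_pred A x).

Lemma arens_fun_multilinear A : multilinear A ->
  multilinear (E := fun i => bidual (E i)) (arens_fun A).
Proof.
move=> lA x j a u v; apply: odual_eq => y.
have [k jE] := perm_split rho j; subst j.
rewrite odualD odualZ /= /arens_val !permute_with.
exact: arens_comp_multilinear.
Qed.

Lemma arens_fun_positive A : positive_op A ->
  positive_op (E := fun i => bidual (E i)) (arens_fun A).
Proof.
move=> A0 x x0; apply/odual_ge0P => y y0 /=.
apply: arens_comp_positive; first by move=> i; exact: x0.
apply: (perm_positive (P := odual_comp y A)); exact: odual_comp_positive.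
Qed.

Fact arens_regular A :
  regular_op (E := fun i => bidual (E i)) (arens_fun A).
Proof.
have [A1 [A2 [lA1 A10 lA2 A20 AE]]] := regmlinP A.
pose B1 := RegMlin (positive_regular lA1 A10).
pose B2 := RegMlin (positive_regular lA2 A20).
exists (arens_fun B1), (arens_fun B2); split.
- exact: arens_fun_multilinear.
- exact: arens_fun_positive.
- exact: arens_fun_multilinear.
- exact: arens_fun_positive.
move=> x; apply: odual_eq => y; rewrite odualD odualN /=.
have := @arens_comp_linear _ _ _ (fun i => x (rho i)) (-1)
  (perm_regmlin rho (odual_comp y A))
  (perm_regmlin rho (odual_comp y B2)) (perm_regmlin rho (odual_comp y B1)).
rewrite /arens_val => ->; first by rewrite scaleN1r addrC.
by move=> t /=; rewrite AE odual_subr scaleN1r addrC.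
Qed.

Definition arens A : regmlin (fun i => bidual (E i)) (bidual F) :=
  RegMlin (arens_regular A).

End ArensExtension.

(* Regular operators are order bounded, so order boundedness is implicit
   here; the coordinate x_j of the base point x is overwritten. *)
Definition disjointness_preserving (R : realType) (I : eqType)
    (E : I -> rieszType R) (F : rieszType R) (A : regmlin E F) : Prop :=
  forall (x : forall i, E i) (j : I) (u v : E j),
    disjoint_vec u v -> disjoint_vec (A (dfwith x u)) (A (dfwith x v)).

Definition is_sublattice (R : realType) (F : rieszType R) (S : set F) : Prop :=
  [/\ S 0, forall (a : R) u v, S u -> S v -> S (a *: u + v),
      forall u v, S u -> S v -> S (rjoin u v)
    & forall u v, S u -> S v -> S (rmeet u v)].

Definition finite_dim (R : realType) (F : rieszType R) (S : set F) : Prop :=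
  exists (k : nat) (e : 'I_k -> F),
    S = [set \sum_(i < k) c i *: e i | c in [set: 'I_k -> R]].

Definition finite_lattice_rank (R : realType) (T : Type) (F : rieszType R)
    (f : T -> F) : Prop :=
  finite_dim (smallest (@is_sublattice R F) (range f)).

(* Main.v *)
(* The sublattice generated by the range of A is spanned by pairwise disjoint
   positive vectors e_i, so A = sum_i A_i e_i with A_i disjointness preserving
   forms, each of constant sign on positive tuples and hence regular.  Then
   AR(A)(x) = sum_i AR(A_i)(x) e_i'', where the canonical images e_i'' are again
   disjoint, and it remains to see that AR(A_i)(x) AR(A_i)(x') = 0 when x and x'
   have disjoint entries in one coordinate.  Two facts give this by induction on
   the number of variables: a disjointness preserving functional is, up to sign,
   an atom of the order dual, so that disjoint elements of the bidual cannot both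
   be nonzero at it; and multilinear forms have no zero divisors. *)
Require Import Defs.
From HB Require Import structures.
From mathcomp Require Import all_boot all_order all_fingroup all_algebra.
From mathcomp Require Import boolp classical_sets functions reals.
From mathcomp Require Import ring lra.

Set Implicit Arguments.
Unset Strict Implicit.
Unset Printing Implicit Defensive.

Import Order.TTheory GRing.Theory Num.Theory.
Local Open Scope ring_scope.

(** * Absolute values, disjointness and positive parts in Riesz spaces *)

Section RieszSpace.
Context {R : realType} {E : rieszType R}.
Implicit Types (x y z u v : E) (a b : R).

Lemma riesz_le_subl x y z : (x - y <= z) = (x <= z + y).
Proof. by rewrite -(riesz_leD2r y (x - y)) subrK. Qed.

Lemma riesz_le_subr x y z : (x <= z - y) = (x + y <= z).
Proof. by rewrite -(riesz_leD2r y x) subrK. Qed.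

Lemma riesz_le_opp2 x y : (- x <= - y) = (y <= x).
Proof. by rewrite -[LHS](riesz_leD2r (x + y)) addKr addrCA addNr addr0. Qed.

Lemma riesz_le_scale a x y : 0 <= a -> x <= y -> a *: x <= a *: y.
Proof.
move=> a0; rewrite -(riesz_subr_ge0 x) => xy.
by rewrite -riesz_subr_ge0 -scalerBr; exact: riesz_scale_ge0.
Qed.

Lemma riesz_le_scaler a b x : 0 <= x -> a <= b -> a *: x <= b *: x.
Proof.
by move=> x0 ab; rewrite -riesz_subr_ge0 -scalerBl riesz_scale_ge0// subr_ge0.
Qed.

Lemma riesz_pscale_le a x y : 0 < a -> (a *: x <= y) = (x <= a^-1 *: y).
Proof.
move=> a0; have an0 : a != 0 by exact: lt0r_neq0.
apply/idP/idP => [/(@riesz_le_scale a^-1)|/(riesz_le_scale (ltW a0))].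
  by rewrite scalerA mulVf// scale1r; apply; rewrite invr_ge0 ltW.
by rewrite scalerA divff// scale1r.
Qed.

Lemma rabs_ge x : x <= rabs x. Proof. exact: rleUl. Qed.
Lemma rabs_geN x : - x <= rabs x. Proof. exact: rleUr. Qed.

Lemma rabs_le x z : x <= z -> - x <= z -> rabs x <= z.
Proof. by move=> xz Nxz; rewrite /rabs rleUx xz. Qed.

Lemma rabs_ge0 x : 0 <= rabs x.
Proof.
(* [rabs x] dominates both x and -x, so twice it dominates their sum 0. *)
have h : 0 <= 2%:R *: rabs x.
  by rewrite scaler_nat mulr2n -(subrr x) riesz_leD ?rabs_ge ?rabs_geN.
have := riesz_le_scale (_ : 0 <= 2%:R^-1 :> R) h.
by rewrite scaler0 scalerA mulVf ?pnatr_eq0// scale1r; apply; rewrite invr_ge0.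
Qed.

Lemma ger0_rabs x : 0 <= x -> rabs x = x.
Proof.
move=> x0; apply/eqP; rewrite eq_le rabs_ge andbT rabs_le//.
by apply: (@le_trans _ _ 0) => //; rewrite -oppr0 riesz_le_opp2.
Qed.

Lemma rabs_eq0 x : rabs x = 0 -> x = 0.
Proof.
move=> x0; apply/eqP; rewrite eq_le -{1}x0 rabs_ge/=.
by rewrite -riesz_le_opp2 oppr0 -x0 rabs_geN.
Qed.

Lemma rabsN x : rabs (- x) = rabs x.
Proof. have le y : rabs (- y) <= rabs y.
  by apply: rabs_le; rewrite ?opprK ?rabs_ge ?rabs_geN.
by apply/eqP; rewrite eq_le le -{1}(opprK x) le.
Qed.

Lemma rabsD_le x y : rabs (x + y) <= rabs x + rabs y.
Proof. 
by apply: rabs_le; rewrite ?opprD riesz_leD ?rabs_ge ?rabs_geN.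
Qed.

Lemma rabsZ_le a x : rabs (a *: x) <= `|a| *: rabs x.
Proof.
have pos b y : 0 <= b -> rabs (b *: y) <= b *: rabs y.
  move=> b0; apply: rabs_le; rewrite -?scalerN riesz_le_scale ?rabs_ge//.
  exact: rabs_geN.
case: (ger0P a) => a0; first exact: pos.
by rewrite -(rabsN (a *: x)) -scaleNr; apply: pos; rewrite oppr_ge0 ltW.
Qed.

(** The form in which disjointness is used: the meet is always nonnegative, so only common lower
    bounds need to be tested. *)
Lemma disjoint_vecP x y :
  disjoint_vec x y <-> (forall z, z <= rabs x -> z <= rabs y -> z <= 0).
Proof.
split=> [<- z zx zy|h]; first by rewrite rlexI zx.
apply/eqP; rewrite eq_le rlexI !rabs_ge0 !andbT.
by apply: h; [exact: rleIl|exact: rleIr].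
Qed.

Lemma disjoint_vec_sym x y : disjoint_vec x y -> disjoint_vec y x.
Proof. by rewrite !disjoint_vecP => h z zx zy; exact: h. Qed.

Lemma disjoint_le x x' y :
  rabs x' <= rabs x -> disjoint_vec x y -> disjoint_vec x' y.
Proof.
by rewrite !disjoint_vecP => xx h z zx zy; apply: h => //; exact: le_trans xx.
Qed.

Lemma disjoint_ge0_le x x' y :
  0 <= x' -> x' <= x -> disjoint_vec x y -> disjoint_vec x' y.
Proof.
by move=> x0 xx; apply: disjoint_le; rewrite !ger0_rabs// (le_trans x0).
Qed.

Lemma disjoint0v y : disjoint_vec 0 y.
Proof. by apply/disjoint_vecP => z; rewrite ger0_rabs. Qed.

Lemma disjoint_self x : disjoint_vec x x -> x = 0.
Proof.
move/disjoint_vecP/(_ _ (lexx _) (lexx _)) => h; apply: rabs_eq0.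
by apply/eqP; rewrite eq_le h rabs_ge0.
Qed.

(** The Riesz decomposition splits the left meet into parts below x and below y; each part is also
    below z. *)
Lemma rmeetDl_le x y z : 0 <= x -> 0 <= y -> 0 <= z ->
  rmeet (x + y) z <= rmeet x z + rmeet y z.
Proof.
move=> x0 y0 z0; set w := rmeet (x + y) z.
have w0 : 0 <= w by rewrite rlexI z0 riesz_addr_ge0.
have [u [v [wE u0 ux v0 vy]]] := riesz_decomp x0 y0 w0 (rleIl _ _).
have wz : w <= z by exact: rleIr.
rewrite wE; apply: riesz_leD; rewrite rlexI ?ux ?vy/=; apply: le_trans wz;
  rewrite wE.
  by rewrite -[leLHS]addr0; exact: riesz_leD.
by rewrite -[leLHS]add0r; exact: riesz_leD.
Qed.

Lemma disjointD x y z :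
  disjoint_vec x z -> disjoint_vec y z -> disjoint_vec (x + y) z.
Proof.
move=> xz yz; apply/disjoint_vecP => w wxy wz.
apply: (@le_trans _ _ (rmeet (rabs x + rabs y) (rabs z))).
  by rewrite rlexI wz andbT (le_trans wxy)// rabsD_le.
apply: le_trans (rmeetDl_le _ _ _) _; rewrite ?rabs_ge0//.
by rewrite xz yz addr0.
Qed.

Lemma disjointZ a x y : disjoint_vec x y -> disjoint_vec (a *: x) y.
Proof.
move=> /disjoint_vecP h; apply/disjoint_vecP => z zx zy.
(* This b dominates both scalars 1 and |a|, so z / b lies below |x| and below |y|. *)
pose b := Num.max 1 `|a|; have b1 : 1 <= b by rewrite le_max lexx.
have b0 : 0 < b by exact: lt_le_trans b1.
have : b^-1 *: z <= 0.
  apply: h; rewrite riesz_pscale_le ?invr_gt0// invrK; last first.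
    by apply: (le_trans zy); rewrite -[leLHS]scale1r riesz_le_scaler ?rabs_ge0.
  apply: (le_trans zx); apply: le_trans (rabsZ_le _ _) _.
  by apply: riesz_le_scaler; [exact: rabs_ge0|rewrite le_max lexx orbT].
by rewrite riesz_pscale_le ?invr_gt0// scaler0.
Qed.

Lemma disjointZZ a b x y :
  disjoint_vec x y -> disjoint_vec (a *: x) (b *: y).
Proof. by move=> xy; apply/disjointZ/disjoint_vec_sym/disjointZ/disjoint_vec_sym. Qed.

Lemma disjoint_suml (I : Type) (r : seq I) (P : pred I) (e : I -> E) y :
  (forall i, P i -> disjoint_vec (e i) y) ->
  disjoint_vec (\sum_(i <- r | P i) e i) y.
Proof.
move=> h; elim/big_rec: _ => [|i x Pi]; first exact: disjoint0v.
by apply: disjointD; exact: h.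
Qed.

(** If z is below both parts, then [rpos x - z] still dominates x and 0, hence [rpos x], which
    forces z <= 0. *)
Lemma disjoint_rpos_rneg x : disjoint_vec (rpos x) (rneg x).
Proof.
apply/disjoint_vecP => z; rewrite !ger0_rabs ?rpos_ge0 ?rneg_ge0// => zp zn.
suff : rpos x <= rpos x - z.
  by rewrite riesz_le_subr -[leRHS]addr0 ![rpos x + _]addrC riesz_leD2r.
rewrite {1}/rpos rleUx riesz_subr_ge0 zp andbT riesz_le_subr addrC.
by rewrite -riesz_le_subr.
Qed.

Lemma rposD_le x v : 0 <= v -> rpos (x + v) <= rpos x + v.
Proof.
move=> v0; rewrite {1}/rpos rleUx riesz_leD2r rleUl/=.
by rewrite riesz_addr_ge0 ?rpos_ge0.
Qed.

Lemma le_rpos x y : x <= y -> rpos x <= rpos y.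
Proof. by move=> xy; rewrite {1}/rpos rleUx rpos_ge0 (le_trans xy)// rleUl. Qed.

Lemma rnegE x : rneg x = rpos (- x).
Proof.
apply/eqP; rewrite eq_le /rneg riesz_le_subl {1}/rpos rleUx.
rewrite -[X in X <= _](add0r x) riesz_leD2r rpos_ge0/=.
rewrite -riesz_le_subl sub0r rleUl/= {1}/rpos rleUx riesz_le_subr addNr.
by rewrite rpos_ge0 -/(rneg x) rneg_ge0.
Qed.

End RieszSpace.

(** * Disjointness preserving functionals: constant sign and atomicity *)

Section DisjointnessPreservingFunctional.
Context {R : realType} {E : rieszType R}.
Implicit Types (x y u v w : E) (f g : E -> R).

(** Disjointness preservation of a functional, written with a product because two reals are disjoint
    exactly when their product is 0. *)
Definition disjoint_form f : Prop :=
  forall u v, disjoint_vec u v -> f u * f v = 0.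

Lemma disjoint_realE (a b : R) : disjoint_vec (a : R^o) (b : R^o) <-> a * b = 0.
Proof.
have absE (c : R) : rabs (c : R^o) = `|c| by exact: maxrN.
rewrite /disjoint_vec !absE -[rmeet _ _]/(Num.min `|a| `|b|).
split=> [/eqP|/eqP]; last first.
  rewrite mulf_eq0 => /orP[] /eqP ->; rewrite normr0.
    by rewrite min_l.
  by rewrite min_r.
by case: leP => _ /eqP/normr0_eq0 ->; rewrite ?mul0r ?mulr0.
Qed.

Lemma disjoint_form_sign f : linear (f : E -> R^o) -> disjoint_form f ->
  (forall w, 0 <= w -> exists M : R, forall u, 0 <= u -> u <= w -> `|f u| <= M) ->
  (forall u, 0 <= u -> 0 <= f u) \/ (forall u, 0 <= u -> f u <= 0).
Proof.
move=> lf df bf.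
have fB x y : f (x - y) = f x - f y by exact: (linear_diff lf).
have f0 : f 0 = 0 by rewrite -(subrr 0) fB subrr.
have fZ (a : R) x : f (a *: x) = a * f x.
  by have := lf a x 0; rewrite f0 !addr0.
apply: contrapT => /not_orP[/existsNP[v /not_implyP[v0 /negP fv]]
  /existsNP[u /not_implyP[u0 /negP fu]]].
move: fu fv; rewrite -!ltNge => fu fv.
have [c cP] := bf v v0; have [M MP] := bf u u0.
have c0 : 0 < c by have := cP _ v0 (lexx _); rewrite ltr0_norm//; lra.
(* Since c bounds |f| on [0, v], this step length keeps f at most c d = f u / 2 on [0, d v]. *)
pose d := f u / (2 * c).
have d0 : 0 < d by rewrite divr_gt0// mulr_gt0.
have step w : 0 <= w -> w <= d *: v -> f w <= f u / 2.
  move=> w0 wd; have : f (d^-1 *: w) <= c.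
    apply: (le_trans (ler_norm _)); apply: cP.
      by apply: riesz_scale_ge0 => //; rewrite invr_ge0 ltW.
    by rewrite riesz_pscale_le ?invr_gt0// invrK.
  rewrite fZ mulrC ler_pdivrMr// => /le_trans; apply.
  suff -> : c * d = f u / 2 by [].
  by rewrite /d; field; rewrite lt0r_neq0.
(* f takes on (u - t v)^+ either the value 0 or f u - t f v >= f u, and it moves
   by at most f u / 2 along a step of length d in t; so it never reaches 0 and is
   unbounded, although 0 <= (u - t v)^+ <= u. *)
pose p (k : nat) := rpos (u - (k%:R * d) *: v).
have pE k : f (p k) = f u - k%:R * d * f v.
  elim: k => [|k IH].
    rewrite /p !mul0r scale0r !subr0; congr f.
    by apply/eqP; rewrite eq_le rleUl {1}/rpos rleUx lexx u0.
  have kS : u - (k%:R * d) *: v = (u - (k.+1%:R * d) *: v) + d *: v.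
    have kE : k%:R * d = k.+1%:R * d - d by rewrite -natr1; ring.
    by rewrite kE scalerBl opprB addrCA [RHS]addrC.
  have dv0 : 0 <= d *: v by apply: riesz_scale_ge0 => //; exact: ltW.
  have : f (p k - p k.+1) <= f u / 2.
    apply: step; rewrite ?riesz_subr_ge0 /p kS.
      by apply: le_rpos; rewrite -[leLHS]addr0 riesz_leD.
    by rewrite riesz_le_subl [leRHS]addrC rposD_le.
  rewrite fB IH => h.
  have kf : k%:R * d * f v <= 0.
    by apply: mulr_ge0_le0; [apply: mulr_ge0 => //; exact: ltW|exact: ltW].
  have p0 : f (p k.+1) != 0 by rewrite gt_eqF//; lra.
  have := df _ _ (disjoint_rpos_rneg (u - (k.+1%:R * d) *: v)).
  move/eqP; rewrite mulf_eq0 (negPf p0)/= => /eqP.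
  by rewrite /rneg fB -/(p k.+1) fB fZ => /eqP; rewrite subr_eq0 => /eqP.
have pM k : f u - k%:R * d * f v <= M.
  rewrite -pE; apply: (le_trans (ler_norm _)); apply: MP; rewrite ?rpos_ge0//.
  rewrite /p {1}/rpos rleUx u0 andbT riesz_le_subl -[leLHS]addr0.
  by rewrite riesz_leD// riesz_scale_ge0// mulr_ge0// ltW.
have dv : 0 < - (d * f v) by rewrite oppr_gt0 pmulr_rlt0.
have := pM (Num.bound (M / - (d * f v))).
have : M / - (d * f v) < (Num.bound (M / - (d * f v)))%:R.
  by apply: le_lt_trans (archi_boundP _) => //; rewrite divr_ge0 ?ltW//;
    have := pM 0%N; lra.
rewrite ltr_pdivrMr// => h1 h2; move: h1; rewrite ltNge => /negP; apply.
by rewrite mulrN mulrA; lra.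
Qed.

(** The kernel of f lies in that of g: if f x = 0, then f agrees on the positive and negative parts
    of x, whose images have product 0, so f, and with it g, vanishes on both. Hence g is the
    multiple of f fixed by one positive x with f x nonzero, or 0 if there is none. *)
Lemma disjoint_form_atom (f g : odual E) : disjoint_form f -> 0 <= g -> g <= f ->
  exists2 c : R, 0 <= c <= 1 & g = c *: f.
Proof.
move=> df g0 gf; have f0 := le_trans g0 gf.
have g0' := (odual_ge0P g).1 g0; have f0' := (odual_ge0P f).1 f0.
move/odual_leP: gf => gf.
have ker x : f x = 0 -> g x = 0.
  move=> fx0; have := df _ _ (disjoint_rpos_rneg x).
  have /eqP := fx0; rewrite {1}(rposBneg x) odual_subr subr_eq0 => /eqP e.
  rewrite e => /eqP; rewrite mulf_eq0 orbb => /eqP n0.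
  have gz y : 0 <= y -> f y = 0 -> g y = 0.
    move=> y0 fy; apply/eqP; rewrite eq_le g0'// andbT.
    by rewrite -fy; exact: gf.
  by rewrite (rposBneg x) odual_subr !gz ?rpos_ge0 ?rneg_ge0 ?subrr// e.
have [[x [x0 /eqP fx]]|fz] := pselect (exists x, 0 <= x /\ f x <> 0); last first.
  have fz' x : 0 <= x -> f x = 0.
    by move=> x0; apply: contrapT => fx; apply: fz; exists x.
  exists 0; first by rewrite lexx ler01.
  rewrite scale0r; apply: odual_eq => x; rewrite [RHS]/(0 : R); apply: ker.
  by rewrite (rposBneg x) odual_subr !fz' ?rpos_ge0 ?rneg_ge0 ?subrr.
have fx0 : (0 : R) < f x by rewrite lt_neqAle eq_sym fx f0'.
exists (g x / f x).
  by rewrite divr_ge0 ?g0' ?f0'//= ler_pdivrMr// mul1r gf.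
apply: odual_eq => y; apply/eqP; rewrite -subr_eq0; apply/eqP.
rewrite odualZ.
have := ker (y - (f y / f x) *: x).
rewrite !odual_subr !odual_scale -![_ *: _]/(_ * _ : R) divfK// subrr => /(_ erefl).
by move=> <-; congr (_ - _); rewrite mulrAC [RHS]mulrAC; congr (_ / _); exact: mulrC.
Qed.

End DisjointnessPreservingFunctional.

(** If f u and g v are nonzero, then g u = f v = 0, and the product at u + v is f u times g v, which
    is nonzero. *)
Lemma linear_forms_mul_eq0 (R : realType) (E : lmodType R) (f g : E -> R^o) :
  linear f -> linear g -> (forall u, (f u : R) * g u = 0) ->
  (forall u, f u = 0) \/ (forall u, g u = 0).
Proof.
move=> lf lg fg; apply: contrapT => /not_orP[/existsNP[u /eqP fu]
  /existsNP[v /eqP gv]].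
have gu : g u = 0.
  by have /eqP := fg u; rewrite mulf_eq0 (negPf fu) => /eqP.
have fv : f v = 0.
  by have /eqP := fg v; rewrite mulf_eq0 (negPf gv) orbF => /eqP.
have := fg (1 *: u + v).
rewrite lf lg gu fv scaler0 add0r addr0 scale1r => /eqP.
by rewrite mulf_eq0 (negPf fu) (negPf gv).
Qed.

(** Overwriting one coordinate after another by a common value makes the two tuples equal while each
    keeps its property. This lifts one-variable arguments to several variables. *)
Lemma tuple_merge (n : nat) (T : 'I_n -> Type) (P Q : (forall i, T i) -> Prop) :
  (forall t s (j : 'I_n), P t -> Q s ->
    exists w : T j, P (dfwith t w) /\ Q (dfwith s w)) ->
  (exists t, P t) -> (exists s, Q s) -> exists t, P t /\ Q t.
Proof.
move=> step [t0 Pt0] [s0 Qs0].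
have merge k : (k <= n)%N -> exists t s, [/\ P t, Q s &
    forall i : 'I_n, (i < k)%N -> t i = s i].
  elim: k => [|k IH] kn; first by exists t0, s0.
  have [t [s [Pt Qs ts]]] := IH (ltnW kn).
  have [w [Pw Qw]] := step t s (Ordinal kn) Pt Qs.
  exists (dfwith t w), (dfwith s w); split=> // i ik.
  have [ji|ij] := eqVneq (Ordinal kn) i.
    by move: w {Pw Qw}; rewrite ji => w; rewrite !dfwith_in.
  rewrite !dfwith_out// ts// ltn_neqAle -ltnS ik andbT.
  by apply: contra ij => /eqP ij; apply/eqP/val_inj.
have [t [s [Pt Qs ts]]] := merge n (leqnn n); exists t; split=> //.
by have -> : t = s by apply: functional_extensionality_dep => i; exact: ts.
Qed.

(** * Arens composites of disjointness preserving forms *)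

Section DisjointForms.
Context {R : realType}.

(** By the Riesz-Kantorovich formula, the meet of |X| and |Y| at f is an infimum over 0 <= g <= f.
    At an atom every such g is a multiple of f, so the infimum is the smaller of |X| f and |Y| f,
    and it must be 0. *)
Lemma odual_disjoint_atom (E : rieszType R) (X Y : odual E) (f : E) :
  0 <= f ->
  (forall g, 0 <= g -> g <= f -> exists2 c : R, 0 <= c <= 1 & g = c *: f) ->
  disjoint_vec X Y -> (X f : R) * Y f = 0.
Proof.
move=> f0 atom XY; set a := rabs X; set b := rabs Y.
have absf (Z : odual E) : `|(Z f : R)| <= rabs Z f.
  rewrite ler_norml lerNl -odualN.
  by have /odual_leP -> // := rabs_ge Z; have /odual_leP -> := rabs_geN Z.
(* The vanishing of the meet at f, with the definition of [odual_meet] unfolded. *)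
have : rk_sup (- a - - b) f = b f.
  have : odual_meet a b f = 0 by rewrite -[odual_meet a b]/(rmeet a b) [rmeet a b]XY.
  rewrite odualN odualD odualN -[rk_sup _ f]rk_funE// => /eqP.
  by rewrite oppr_eq0 subr_eq0 => /eqP.
move=> bE; have : b f <= Num.max 0 (b f - a f : R).
  rewrite -[leLHS]bE; apply: rk_le => // g g0 gf.
  have [c /andP[c0 c1] ->] := atom g g0 gf.
  rewrite odual_scale odualD odualN odualN opprK addrC.
  rewrite -[_ *: _]/(c * (b f - a f) : R) le_max.
  by case: (leP 0 (b f - a f : R)) => h; apply/orP; [right|left]; nra.
have := absf X; have := absf Y; rewrite -/a -/b le_max => hY hX /orP h.
have {h} : (a f : R) <= 0 \/ (b f : R) <= 0 by case: h => ?; [right|left]; lra.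
case=> h; apply/eqP; rewrite mulf_eq0 -!normr_le0.
  by rewrite (le_trans hX).
by rewrite (le_trans hY) ?orbT.
Qed.

Lemma disjoint_form_pos_or_neg (E : rieszType R) (f : odual E) :
  disjoint_form f -> 0 <= f \/ 0 <= - f.
Proof.
move=> df; have [|f0|f0] := disjoint_form_sign (odual_linear f) df.
- move=> w w0; have [c [d h]] := odual_bounded f 0 w.
  exists (`|c : R| + `|d : R|) => u u0 uw; have [cf fd] := h u u0 uw.
  have := ler_norm (- (c : R)); have := ler_norm (d : R).
  have := normr_ge0 (c : R); have := normr_ge0 (d : R).
  rewrite normrN ler_norml => *; apply/andP; split.
    by apply: le_trans cf; lra.
  by apply: (le_trans fd); lra.
- by left; apply/odual_ge0P.
- by right; apply/odual_ge0P => u u0; rewrite odualN oppr_ge0 f0.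
Qed.

(** Either f or -f is positive and hence an atom of the order dual; the change of sign cancels in
    the product. *)
Lemma bidual_disjoint_eval (E : rieszType R) (f : odual E) (X Y : bidual E) :
  disjoint_form f -> disjoint_vec X Y -> (X f : R) * Y f = 0.
Proof.
have pos (g : odual E) : disjoint_form g -> 0 <= g -> disjoint_vec X Y ->
    (X g : R) * Y g = 0.
  move=> dg g0; apply: odual_disjoint_atom => // h h0 hg.
  exact: disjoint_form_atom.
move=> df XY; case: (disjoint_form_pos_or_neg df) => f0; first exact: pos.
have dNf : disjoint_form (- f).
  by move=> u v uv; rewrite !odualN mulrNN df.
have := pos _ dNf f0 XY.
by rewrite -scaleN1r !odual_scale !scaleN1r mulrNN.
Qed.

Lemma regmlin_multilinear (I : eqType) (E : I -> rieszType R) (F : rieszType R)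
  (A : regmlin E F) : multilinear A.
Proof.
have [P [Q [lP _ lQ _ AE]]] := regmlinP A => x j a u v.
by rewrite !AE lP lQ scalerBr opprD addrACA.
Qed.

(** Points where C and D do not vanish can be merged into one: in each variable the two slices are
    nonzero linear forms, so they are nonzero at a common vector. *)
Lemma multilinear_forms_mul_eq0 (n : nat) (G : 'I_n -> rieszType R)
    (C D : (forall i, G i) -> R^o) :
  multilinear C -> multilinear D -> (forall t, (C t : R) * D t = 0) ->
  (forall t, C t = 0) \/ (forall t, D t = 0).
Proof.
move=> lC lD CD; apply: contrapT => /not_orP[/existsNP[t Ct] /existsNP[s Ds]].
have step (t' s' : forall i, G i) (j : 'I_n) : C t' <> 0 -> D s' <> 0 ->
    exists w : G j, C (dfwith t' w) <> 0 /\ D (dfwith s' w) <> 0.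
  move=> Ct' Ds'; apply: contrapT => h.
  have dfwithE (y : forall i, G i) : dfwith y (y j) = y.
    by apply: functional_extensionality_dep => i; case: dfwithP.
  have [w||] := linear_forms_mul_eq0 (lC t' j) (lD s' j).
  - apply/eqP; rewrite mulf_eq0; apply: contrapT => /negP; rewrite negb_or.
    by move=> /andP[/eqP ? /eqP ?]; apply: h; exists w.
  - by move/(_ (t' j)); rewrite dfwithE.
  - by move/(_ (s' j)); rewrite dfwithE.
have [w [/eqP Cw /eqP Dw]] :=
  tuple_merge step (ex_intro _ t Ct) (ex_intro _ s Ds).
by have /eqP := CD w; rewrite mulf_eq0 (negPf Cw) (negPf Dw).
Qed.

Lemma disjointness_preserving_curry (n : nat) (G : 'I_n.+1 -> rieszType R)
    (B : regmlin G R^o) (t : forall i, G (lift ord0 i)) :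
  disjointness_preserving B -> disjoint_form (curry B t).
Proof.
move=> dB u v uv; apply/disjoint_realE.
rewrite /= (dcons_with0 0 u) (dcons_with0 0 v); exact: dB.
Qed.

(** For disjoint u and v in a later variable, the two functionals of the first variable have product
    0 everywhere. One of them is therefore the zero functional, and x vanishes at it. *)
Lemma disjointness_preserving_arens_step (n : nat) (G : 'I_n.+1 -> rieszType R)
    (B : regmlin G R^o) (x : bidual (G ord0)) :
  disjointness_preserving B -> disjointness_preserving (arens_step x B).
Proof.
move=> dB t j u v uv; apply/disjoint_realE => /=.
have [w||] := @linear_forms_mul_eq0 R (G ord0) (curry B (dfwith t u))
  (curry B (dfwith t v)) (odual_linear _) (odual_linear _).
- by apply/disjoint_realE; rewrite /= !dcons_withS; exact: dB.
- move=> e; have -> : curry B (dfwith t u) = 0 by exact: odual_eq.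
  by rewrite odual0 mul0r.
- move=> e; have -> : curry B (dfwith t v) = 0 by exact: odual_eq.
  by rewrite odual0 mulr0.
Qed.

Lemma arens_comp_eq0 (n : nat) (G : 'I_n.+1 -> rieszType R)
    (x : forall i, bidual (G i)) (B : regmlin G R^o) :
  (forall t, B t = 0) -> arens_comp x B = 0.
Proof.
(* A zero form satisfies B = B + B pointwise, so its value equals twice itself. *)
move=> B0; have := @arens_comp_linear _ _ _ x 1 B B B.
rewrite scale1r => /(_ _)/esym/eqP.
by rewrite -subr_eq0 addrK => /(_ _)/eqP; apply=> t; rewrite B0 scaler0 addr0.
Qed.

(** Induction on the number of variables. Disjoint entries in a later variable survive the first
    step, which yields the same disjointness preserving form for both tuples. *)
Lemma arens_comp_disjoint (n : nat) (G : 'I_n.+1 -> rieszType R)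
    (B : regmlin G R^o) (x : forall i, bidual (G i)) (j : 'I_n.+1)
    (u v : bidual (G j)) :
  disjointness_preserving B -> disjoint_vec u v ->
  (arens_comp (dfwith x u) B : R) * arens_comp (dfwith x v) B = 0.
Proof.
elim: n G B x j u v => [|n IH] G B x j u v dB uv.
  case: (unliftP ord0 j) u v uv => [[]//|->] u v uv /=; rewrite !dfwith_in.
  by apply: bidual_disjoint_eval => //; exact: disjointness_preserving_curry.
case: (unliftP ord0 j) u v uv => [k|] -> u v uv /=; last first.
  have tlE (w : bidual (G ord0)) :
      (fun i : 'I_n.+1 => dfwith x w (lift ord0 i)) = (fun i => x (lift ord0 i)).
    by apply: functional_extensionality_dep => i; rewrite dfwith_out// neq_lift.
  rewrite !tlE !dfwith_in.
  (* Disjoint entries in the first variable give two forms in the remaining ones with product 0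
     everywhere, so one of these forms is zero. *)
  have [t|h|h] := multilinear_forms_mul_eq0
    (regmlin_multilinear (arens_step u B)) (regmlin_multilinear (arens_step v B)).
  - by apply: bidual_disjoint_eval => //; exact: disjointness_preserving_curry.
  - by rewrite (arens_comp_eq0 _ h) mul0r.
  - by rewrite (arens_comp_eq0 _ h) mulr0.
have tlE (w : bidual (G (lift ord0 k))) :
    (fun i : 'I_n.+1 => dfwith x w (lift ord0 i)) =
    dfwith (fun i => x (lift ord0 i)) w.
  apply: functional_extensionality_dep => i; have [<-|ki] := eqVneq k i.
    by rewrite !dfwith_in.
  by rewrite !dfwith_out// (inj_eq lift_inj).
have hdE (w : bidual (G (lift ord0 k))) : dfwith x w ord0 = x ord0.
  by rewrite dfwith_out// eq_sym neq_lift.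
rewrite !tlE !hdE; apply: IH => //.
exact: disjointness_preserving_arens_step.
Qed.

End DisjointForms.

(** * The component of a positive functional carried by a disjoint complement *)

Section DisjointComponent.
Context {R : realType} {F : rieszType R}.
Variables (f : odual F) (e : F).
Hypothesis f0 : 0 <= f.
Implicit Types x y u v : F.

Let f_ge0 x : 0 <= x -> 0 <= f x. Proof. exact: (odual_ge0P f).1. Qed.

Let f_mono x y : x <= y -> f x <= f y.
Proof.
by rewrite -riesz_subr_ge0 => /f_ge0; rewrite odual_subr riesz_subr_ge0.
Qed.

(** The supremum [g] of these sets is the part of f seen by vectors disjoint from e; it is additive
    on the cone because Riesz decomposition stays among vectors disjoint from e. *)
Let T x : set R :=
  [set (f y : R) | y in [set y | [/\ 0 <= y, y <= x & disjoint_vec y e]]]%classic.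
Let g x : R^o := sup (T x).

Let g_has_sup x : 0 <= x -> has_sup (T x).
Proof.
move=> x0; split.
  by exists (f 0); exists 0 => //; split=> //; exact: disjoint0v.
by exists (f x) => _ [y [_ yx _] <-]; exact: f_mono.
Qed.

Let g_ub x y : 0 <= y -> y <= x -> disjoint_vec y e -> (f y : R) <= g x.
Proof.
move=> y0 yx ye; apply: sup_upper_bound; last by exists y.
exact/g_has_sup/(le_trans y0).
Qed.

Let g_le x (c : R) : 0 <= x ->
  (forall y, 0 <= y -> y <= x -> disjoint_vec y e -> (f y : R) <= c) -> g x <= c.
Proof.
move=> x0 h; apply: ge_sup; first by have [] := g_has_sup x0.
by move=> _ [y [y0 yx ye] <-]; exact: h.
Qed.

Let g_ge0 x : 0 <= x -> 0 <= g x.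
Proof. by move=> x0; rewrite -(odual0 f) g_ub//; exact: disjoint0v. Qed.

Let gD x y : 0 <= x -> 0 <= y -> g (x + y) = g x + g y.
Proof.
move=> x0 y0; have xy0 := riesz_addr_ge0 x0 y0; apply/eqP; rewrite eq_le.
apply/andP; split.
  apply: g_le => // z z0 zxy ze.
  have [u [v [zE u0 ux v0 vy]]] := riesz_decomp x0 y0 z0 zxy.
  have uz : u <= z by rewrite zE -[leLHS]addr0 riesz_leD.
  have vz : v <= z by rewrite zE -[leLHS]add0r riesz_leD.
  rewrite zE odual_addr; apply: lerD; apply: g_ub => //.
    exact: disjoint_ge0_le uz ze.
  exact: disjoint_ge0_le vz ze.
rewrite -(@lerBrDr R); apply: g_le => // u u0 ux ue.
rewrite lerBrDr addrC -(@lerBrDr R); apply: g_le => // v v0 vy ve.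
rewrite lerBrDr -odual_addr; apply: g_ub; first exact: riesz_addr_ge0.
  by rewrite addrC; exact: riesz_leD.
exact: disjointD.
Qed.

Let gZ (a : R) x : 0 <= a -> 0 <= x -> g (a *: x) = a *: g x.
Proof.
have le (b : R) y : 0 < b -> 0 <= y -> b *: g y <= g (b *: y).
  move=> b0 y0; rewrite -[leRHS](mulVKf (lt0r_neq0 b0)).
  apply: (@ler_wpM2l R); first exact: ltW.
  apply: g_le => // u u0 uy ue; rewrite mulrC ler_pdivlMr// mulrC.
  rewrite -[_ * _]/(b *: f u) -odual_scale.
  apply: g_ub; [|exact/riesz_le_scale/uy/ltW|exact: disjointZ].
  exact/riesz_scale_ge0/u0/ltW.
move=> a0 x0; move: a0; rewrite le_eqVlt => /predU1P[<-|a0].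
  rewrite !scale0r; apply/eqP; rewrite eq_le g_ge0// andbT.
  by apply: g_le => // y y0 yx _; rewrite -(odual0 f) f_mono.
apply/eqP; rewrite eq_le le// andbT.
have ai : 0 < a^-1 by rewrite invr_gt0.
have := le _ (a *: x) ai; rewrite riesz_scale_ge0 ?(ltW a0)// => /(_ isT).
rewrite scalerA mulVf ?lt0r_neq0// scale1r => h.
have := @ler_wpM2l R _ (ltW a0) _ _ h.
by rewrite -[X in X <= _]/(a * (a^-1 * _)) mulVKf// lt0r_neq0.
Qed.

(** This splits f into p, which vanishes at e >= 0, and f - p, which vanishes on positive vectors
    disjoint from e. The former holds since a vector in [0, e] disjoint from e is disjoint from
    itself. *)
Lemma odual_disjoint_component : exists p : odual F,
  [/\ 0 <= p, p <= f, 0 <= e -> p e = 0 &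
    forall x, 0 <= x -> disjoint_vec x e -> p x = f x].
Proof.
have [lp pE'] := cone_extend gD gZ; pose p x : R^o := g (rpos x) - g (rneg x).
have pE x : 0 <= x -> p x = g x by exact: pE'.
have pP : p \in @odual_pred R F.
  by apply: positive_odual_pred => // x x0; rewrite pE// g_ge0.
exists (ODual pP); split=> [|||x x0 xe].
- by apply/odual_ge0P => x x0 /=; rewrite pE// g_ge0.
- by apply/odual_leP => x x0 /=; rewrite pE//; apply: g_le => // y y0 yx _;
    exact: f_mono.
- move=> e0; rewrite /= pE//; apply/eqP; rewrite eq_le g_ge0// andbT.
  apply: g_le => // y y0 ye yde; suff -> : y = 0 by rewrite odual0.
  have eye : disjoint_vec e y by exact: disjoint_vec_sym.
  exact: disjoint_self (disjoint_ge0_le y0 ye eye).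
rewrite /= pE//; apply/eqP; rewrite eq_le g_ub// andbT.
by apply: g_le => // y y0 yx _; exact: f_mono.
Qed.

End DisjointComponent.

(** * The canonical embedding into the bidual preserves disjointness *)

Section BidualEvaluation.
Context {R : realType} {F : rieszType R}.

Fact eval_pred (x : F) : (fun y : odual F => y x) \in @odual_pred R (odual F).
Proof.
have pos (u : F) : 0 <= u -> (fun y : odual F => y u) \in @odual_pred R (odual F).
  by move=> u0; apply: positive_odual_pred => // y /odual_ge0P; apply.
have -> : (fun y : odual F => y x) = (fun y => y (rpos x) - y (rneg x)).
  by apply: funext => y; rewrite {1}(rposBneg x) odual_subr.
by apply: odual_pred_sub; apply: pos; [exact: rpos_ge0|exact: rneg_ge0].
Qed.

Definition bidual_eval (x : F) : bidual F := ODual (eval_pred x).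

Lemma bidual_eval_disjoint (x z : F) : 0 <= x -> 0 <= z ->
  disjoint_vec x z -> disjoint_vec (bidual_eval x) (bidual_eval z).
Proof.
move=> x0 z0 xz; apply/disjoint_vecP => Z.
have ev0 (u : F) : 0 <= u -> 0 <= bidual_eval u.
  by move=> u0; apply/odual_ge0P => y /odual_ge0P; apply.
rewrite !ger0_rabs ?ev0// => /odual_leP Zx /odual_leP Zz.
apply/odual_leP => f f0.
(* Splitting f as (f - p) + p bounds Z f by (f - p) x + p z, and both terms are 0. *)
have [p [p0 pf pz px]] := odual_disjoint_component z f0.
rewrite -[f in leLHS](subrK p) odual_addr -[leRHS]/(0 : R) -[leRHS]addr0 lerD//.
  apply: (le_trans (Zx _ _)); first by rewrite riesz_subr_ge0.
  by rewrite -[leLHS]/((f - p) x) odualD odualN px// subrr.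
by apply: (le_trans (Zz _ _)) => //=; rewrite pz.
Qed.

End BidualEvaluation.

(** * Scalar multiples in Archimedean Riesz spaces *)

Section Archimedean.
Context {R : realType} {F : rieszType R}.
Hypothesis archF : archimedean_riesz F.
Implicit Types x y z e : F.

Lemma archimedean_le_scale x z :
  0 <= x -> (forall t : R, 0 < t -> x <= t *: z) -> x = 0.
Proof.
move=> x0 xz; apply: (archF (y := z) x0) => -[|n].
  by rewrite mulr0n (le_trans x0)// -[leRHS]scale1r xz.
have n0 : (0 : R) < n.+1%:R by rewrite ltr0n.
by rewrite -scaler_nat riesz_pscale_le// xz// invr_gt0.
Qed.

Lemma archimedean_bound e x : 0 <= e -> e != 0 ->
  exists M : R, forall t, t *: e <= x -> t <= M.
Proof.
move=> e0 en0; apply: contrapT => /forallNP h.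
move/eqP: en0; apply; apply: (archF (y := x) e0) => n.
have /existsNP[t /not_implyP[te /negP]] := h n%:R.
rewrite -ltNge => nt; apply: le_trans te.
by rewrite -scaler_nat riesz_le_scaler// ltW.
Qed.

(** The supremum c of the admissible scalars is itself admissible: the positive part of c e - x lies
    below d e for every d > 0, hence is 0. *)
Lemma archimedean_max_multiple e x : 0 <= e -> e != 0 -> 0 <= x ->
  exists c : R, [/\ 0 <= c, c *: e <= x & forall t, t *: e <= x -> t <= c].
Proof.
move=> e0 en0 x0; have [M MP] := archimedean_bound x e0 en0.
pose T : set R := [set t | t *: e <= x]%classic.
have T0 : T 0 by rewrite /T/= scale0r.
have supT : has_sup T by split; [exists 0|exists M => t /MP].
have ub t : t *: e <= x -> t <= sup T by move=> h; exact: sup_upper_bound.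
exists (sup T); split=> //; first exact: ub.
have : rpos (sup T *: e - x) = 0.
  apply: (archimedean_le_scale (z := e)) (rpos_ge0 _) _ => d d0.
  rewrite {1}/rpos rleUx riesz_scale_ge0 ?(ltW d0)// andbT.
  have [t Tt /ltW td] := sup_adherent d0 supT.
  rewrite riesz_le_subl addrC -riesz_le_subl -scalerBl.
  by apply: le_trans Tt; exact: riesz_le_scaler.
by move=> r0; rewrite -riesz_subr_ge0 -oppr0 -riesz_le_opp2 opprK opprB -r0 rleUl.
Qed.

End Archimedean.

(** * Systems of pairwise disjoint positive vectors *)

Section DisjointSystem.
Context {R : realType} {F : rieszType R}.
Implicit Types (S : set F) (x y : F).

Definition disjoint_system S (k : nat) (e : 'I_k -> F) : Prop :=
  [/\ forall i, S (e i), forall i, 0 <= e i, forall i, e i != 0 &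
      forall i j, i != j -> disjoint_vec (e i) (e j)].

(** With w the sum of the other terms, |c i| e i is below the sum of |c i e i + w| and |w|. Taking
    the meet with |c i| e i removes |w|, which is disjoint from it. *)
Lemma disjoint_system_coef_le S k (e : 'I_k -> F) (c : 'I_k -> R) i :
  disjoint_system S e -> `|c i| *: e i <= rabs (\sum_j c j *: e j).
Proof.
move=> [_ e0 _ de]; rewrite (bigD1 i)//=; set w := (\sum_(j | _) _).
have wi : disjoint_vec w (`|c i| *: e i).
  by apply: disjoint_suml => j ji; exact/disjointZZ/de.
have ci0 : 0 <= `|c i| *: e i by exact: riesz_scale_ge0.
have h : `|c i| *: e i <= rabs (c i *: e i + w) + rabs w.
  apply: (@le_trans _ _ (rabs (c i *: e i))).
    case: (ger0P (c i)) => _; first exact: rabs_ge.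
    by rewrite scaleNr; exact: rabs_geN.
  rewrite -{1}[c i *: e i](addrK w) -(rabsN w); exact: rabsD_le.
have : `|c i| *: e i <= rmeet (rabs (c i *: e i + w) + rabs w) (`|c i| *: e i).
  by rewrite rlexI h lexx.
move/le_trans; apply; apply: le_trans (rmeetDl_le _ _ _) _; rewrite ?rabs_ge0//.
move: wi; rewrite /disjoint_vec (ger0_rabs ci0) => ->.
by rewrite addr0; exact: rleIl.
Qed.

Lemma disjoint_system_free S k (e : 'I_k -> F) (c : 'I_k -> R) i :
  disjoint_system S e -> \sum_j c j *: e j = 0 -> c i = 0.
Proof.
move=> se ce0; have := disjoint_system_coef_le c i se.
rewrite ce0 ger0_rabs// => ci; have [_ e0 en0 _] := se.
have /eqP : `|c i| *: e i = 0.
  by apply/eqP; rewrite eq_le ci riesz_scale_ge0.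
by rewrite scaler_eq0 (negPf (en0 i)) orbF normr_eq0 => /eqP.
Qed.

Lemma disjoint_system_size S d k (b : 'I_d -> F) (e : 'I_k -> F) :
  (forall x, S x -> exists c : 'I_d -> R, x = \sum_i c i *: b i) ->
  disjoint_system S e -> (k <= d)%N.
Proof.
move=> Sb se; have [Se _ _ _] := se; rewrite leqNgt; apply/negP => dk.
have [M ME] := choice (fun i => Sb _ (Se i)).
pose A : 'M[R]_(k, d) := \matrix_(i, j) M i j.
(* More vectors than the dimension d give a nonzero row vector in the left kernel of the coefficient
   matrix, that is, a linear relation among the e i. *)
have : kermx A != 0.
  by rewrite -mxrank_eq0 mxrank_ker subn_eq0 -ltnNge
    (leq_ltn_trans (rank_leq_col _)).
case/rowV0Pn => v /sub_kermxP vA /rV0Pn[i /eqP]; apply.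
apply: (disjoint_system_free (c := fun i => v 0 i) i se).
transitivity (\sum_j (v *m A) 0 j *: b j); last first.
  by rewrite vA big1// => j _; rewrite mxE scale0r.
under eq_bigr do rewrite ME scaler_sumr.
rewrite exchange_big; apply: eq_bigr => j _ /=.
rewrite mxE scaler_suml; apply: eq_bigr => l _.
by rewrite mxE scalerA.
Qed.

Lemma disjoint_system_extend S k (e : 'I_k -> F) q :
  disjoint_system S e -> S q -> 0 <= q -> q != 0 ->
  (forall i, disjoint_vec q (e i)) ->
  exists e' : 'I_k.+1 -> F, disjoint_system S e'.
Proof.
move=> [Se e0 en0 de] Sq q0 qn0 dq.
exists (fun i => if unlift ord0 i is Some j then e j else q).
split=> [i|i|i|i j]; first by case: unliftP.
- by case: unliftP.
- by case: unliftP.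
case: (unliftP ord0 i) => [i' ->|->]; case: (unliftP ord0 j) => [j' ->|->] //.
- by rewrite (inj_eq lift_inj); exact: de.
- by move=> _; exact/disjoint_vec_sym/dq.
Qed.

Lemma disjoint_system_replace S k (e : 'I_k -> F) i p :
  disjoint_system S e -> S p -> 0 <= p -> p != 0 -> p <= e i ->
  disjoint_system S (fun j => if j == i then p else e j).
Proof.
move=> [Se e0 en0 de] Sp p0 pn0 pe.
have dp j : j != i -> disjoint_vec p (e j).
  by move=> ji; apply: (disjoint_ge0_le p0 pe); apply: de; rewrite eq_sym.
split=> [j|j|j|j l]; try by case: (j == i).
case: (eqVneq j i) => [->|ji]; case: (eqVneq l i) => [li|li] => //.
- by move=> _; exact: dp.
- by move=> _; exact/disjoint_vec_sym/dp.
- exact: de.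
Qed.

End DisjointSystem.

(** * Disjoint bases of finite dimensional Archimedean sublattices *)

Section FiniteDimensionalSublattice.
Context {R : realType} {F : rieszType R}.
Hypothesis archF : archimedean_riesz F.
Variable S : set F.
Hypothesis subS : is_sublattice S.

Let S0 : S 0. Proof. by have [] := subS. Qed.
Let SL (a : R) x y : S x -> S y -> S (a *: x + y).
Proof. by have [_ h _ _] := subS; exact: h. Qed.
Let SZ (a : R) x : S x -> S (a *: x).
Proof. by move=> Sx; rewrite -[_ *: _]addr0; exact: SL Sx S0. Qed.
Let SB x y : S x -> S y -> S (x - y).
Proof. by move=> Sx Sy; rewrite addrC -scaleN1r; exact: SL. Qed.
Let Spos x : S x -> S (rpos x).
Proof. by move=> Sx; have [_ _ h _] := subS; exact: h. Qed.
Let Smeet x y : S x -> S y -> S (rmeet x y).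
Proof. by have [_ _ _ h] := subS; exact: h. Qed.

(* Splitting e_i along the sign of y - t e_i would enlarge the system, so
   one of the two pieces vanishes for every t > 0. *)
Lemma maximal_system_residue k (e : 'I_k -> F) x i :
  disjoint_system S e -> (forall e' : 'I_k.+1 -> F, ~ disjoint_system S e') ->
  S x -> 0 <= x ->
  exists c : R, [/\ 0 <= c, c *: e i <= x & disjoint_vec (x - c *: e i) (e i)].
Proof.
move=> se emax Sx x0; have [Se e0 en0 de] := se.
have [c [c0 cx cmax]] := archimedean_max_multiple archF (e0 i) (en0 i) x0.
exists c; split=> //; set y := x - c *: e i.
have y0 : 0 <= y by rewrite riesz_subr_ge0.
have Sy : S y by apply: SB => //; exact: SZ.
rewrite /disjoint_vec !ger0_rabs//.
have ye0 : 0 <= rmeet y (e i) by rewrite rlexI y0 e0.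
apply: (archimedean_le_scale archF (z := e i) ye0) => t t0.
have te0 : 0 <= t *: e i by apply: riesz_scale_ge0 => //; exact: ltW.
set z := y - t *: e i.
have Sz : S z by apply: SB => //; exact: SZ.
have Sn : S (rneg z) by apply: SB => //; exact: Spos.
pose p := rmeet (rneg z) (e i); pose q := rmeet (rpos z) (e i).
have p0 : 0 <= p by rewrite rlexI rneg_ge0 e0.
have q0 : 0 <= q by rewrite rlexI rpos_ge0 e0.
(* If p were 0, the negative part of z, being at most t e i, would be disjoint from itself. Then z
   >= 0, so (c + t) e i <= x, against the maximality of c. *)
have pn0 : p != 0.
  apply/eqP => pz; have nte : rneg z <= t *: e i.
    rewrite rnegE /rpos rleUx te0 andbT /z opprB riesz_le_subl.
    by rewrite -[leLHS]addr0 riesz_leD.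
  have ne : disjoint_vec (e i) (rneg z).
    by apply: disjoint_vec_sym; rewrite /disjoint_vec !ger0_rabs ?rneg_ge0.
  have nz : rneg z = 0.
    apply: disjoint_self; apply: (disjoint_ge0_le (rneg_ge0 z) nte).
    exact: disjointZ.
  have : 0 <= z by rewrite (rposBneg z) nz subr0 rpos_ge0.
  rewrite riesz_subr_ge0 riesz_le_subr -scalerDl => /cmax.
  by lra.
(* Otherwise p in place of e i, together with q, gives a system of k + 1 vectors. *)
have qz : q = 0.
  apply/eqP; apply: contrapT => /negP qn0.
  have sp := disjoint_system_replace se (Smeet Sn (Se i)) p0 pn0 (rleIr _ _).
  have [|j|e' se'] := disjoint_system_extend (q := q) sp _ q0 qn0.
  - by apply: Smeet => //; exact: Spos.
  - case: eqP => [_|/eqP ji]; last first.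
      by apply: (disjoint_ge0_le q0 (rleIr _ _)); apply: de; rewrite eq_sym.
    apply: (disjoint_ge0_le q0 (rleIl _ _)); apply: disjoint_vec_sym.
    apply: (disjoint_ge0_le p0 (rleIl _ _)); apply: disjoint_vec_sym.
    exact: disjoint_rpos_rneg.
  exact: emax se'.
apply: (@le_trans _ _ (rmeet (rpos z + t *: e i) (e i))).
  by rewrite rlexI rleIr andbT (le_trans (rleIl _ _))// -riesz_le_subl rleUl.
apply: le_trans (rmeetDl_le _ _ _) _; rewrite ?rpos_ge0//.
by rewrite -/q qz add0r rleIl.
Qed.

(** Subtracting from x >= 0 its largest multiple of each e i in turn leaves a positive y disjoint
    from the whole system; disjointness already gained persists because the remainder only
    decreases. A nonzero y would enlarge the system. *)
Lemma maximal_system_generates k (e : 'I_k -> F) :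
  disjoint_system S e -> (forall e' : 'I_k.+1 -> F, ~ disjoint_system S e') ->
  forall x, S x -> exists c : 'I_k -> R, x = \sum_i c i *: e i.
Proof.
move=> se emax; have [Se e0 en0 de] := se.
have pos x : S x -> 0 <= x -> exists c : 'I_k -> R, x = \sum_i c i *: e i.
  move=> Sx x0.
  have [y [y0 Sy [c xE] yd]] : exists y, [/\ 0 <= y, S y,
      exists c : 'I_k -> R, x = y + \sum_i c i *: e i &
      forall i, i \in enum 'I_k -> disjoint_vec y (e i)].
    elim: (enum _) => [|i r [y [y0 Sy [c xE] yd]]].
      exists x; split=> //; exists (fun=> 0).
      by rewrite big1 ?addr0// => i _; rewrite scale0r.
    have [d [d0 dy yi]] := maximal_system_residue i se emax Sy y0.
    have y'0 : 0 <= y - d *: e i by rewrite riesz_subr_ge0.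
    exists (y - d *: e i); split=> //.
    - by apply: SB => //; exact: SZ.
    - exists (fun j => c j + (if j == i then d else 0)).
      have dE : \sum_j (if j == i then d else 0) *: e j = d *: e i.
        rewrite (bigD1 i)//= eqxx big1 ?addr0// => j /negPf ->.
        by rewrite scale0r.
      under eq_bigr do rewrite scalerDl.
      by rewrite big_split /= dE addrACA addNr addr0.
    - move=> j; rewrite inE => /orP[/eqP -> //|jr].
      apply: (disjoint_ge0_le y'0 _ (yd j jr)).
      rewrite riesz_le_subl -[leLHS]addr0 riesz_leD// riesz_scale_ge0//.
  suff yz : y = 0 by exists c; rewrite {1}xE yz add0r.
  apply: contrapT => /eqP yn0.
  have [i|e' se'] := disjoint_system_extend se Sy y0 yn0.
    by apply: yd; rewrite mem_enum.
  exact: emax se'.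
move=> x Sx; have [c cE] := pos _ (Spos Sx) (rpos_ge0 x).
have [d dE] := pos _ (SB (Spos Sx) Sx : S (rneg x)) (rneg_ge0 x).
exists (fun i => c i - d i); rewrite {1}(rposBneg x) cE dE -sumrB.
by apply: eq_bigr => i _; rewrite scalerBl.
Qed.

(** The dimension bounds the size of disjoint systems and the empty one exists, so there is a system
    of largest size, and it generates. *)
Lemma finite_dim_disjoint_basis : finite_dim S ->
  exists (k : nat) (e : 'I_k -> F), disjoint_system S e /\
    forall x, S x -> exists c : 'I_k -> R, x = \sum_i c i *: e i.
Proof.
move=> [d [b Sb]].
pose P k := `[< exists e : 'I_k -> F, disjoint_system S e >].
have P0 : exists k, P k by exists 0%N; apply/asboolP; exists (fun=> 0); split; case.
have Pd k : P k -> (k <= d)%N.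
  move=> /asboolP[e]; apply: (disjoint_system_size (b := b)) => x.
  by rewrite Sb => -[c _ <-]; exists c.
case: (ex_maxnP P0 Pd) => k /asboolP[e se] kmax.
exists k, e; split=> //; apply: maximal_system_generates => // e' se'.
have : P k.+1 by apply/asboolP; exists e'.
by move/kmax; rewrite ltnn.
Qed.

End FiniteDimensionalSublattice.

Lemma smallest_sublattice (R : realType) (F : rieszType R) (X : set F) :
  is_sublattice (smallest (@is_sublattice R F) X).
Proof.
split=> [M [[M0 _ _ _] _] //|a u v Xu Xv M [subM XM]|u v Xu Xv M [subM XM]
  |u v Xu Xv M [subM XM]]; have [_ ML MU MI] := subM;
  have Mu := Xu M (conj subM XM); have Mv := Xv M (conj subM XM).
- exact: ML.
- exact: MU.
- exact: MI.
Qed.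

(** * Regularity and linear combinations of multilinear forms *)

Section RegularForms.
Context {R : realType}.

(** Each slice at a positive tuple has constant sign on the cone. Merging a positive tuple of
    negative value with one of positive value would be contradictory, so f or -f is positive. *)
Lemma disjoint_multilinear_regular (n : nat) (E : 'I_n -> rieszType R)
    (f : (forall i, E i) -> R^o) :
  multilinear f ->
  (forall x j (u v : E j), disjoint_vec u v ->
    (f (dfwith x u) : R) * f (dfwith x v) = 0) ->
  (forall x j (w : E j), (forall i, 0 <= x i) -> 0 <= w ->
    exists M : R, forall u, 0 <= u -> u <= w -> `|f (dfwith x u) : R| <= M) ->
  regular_op f.
Proof.
move=> lf df bf.
have sign (x : forall i, E i) j : (forall i, 0 <= x i) ->
    (forall u : E j, 0 <= u -> (0 : R) <= f (dfwith x u)) \/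
    (forall u : E j, 0 <= u -> (f (dfwith x u) : R) <= 0).
  move=> x0; apply: (disjoint_form_sign (lf x j) (df x j)) => w w0.
  exact: bf.
have dfwithE (x : forall i, E i) j : dfwith x (x j) = x.
  by apply: functional_extensionality_dep => i; case: dfwithP.
have dfwith_ge0 (x : forall i, E i) j (u : E j) :
    (forall i, 0 <= x i) -> 0 <= u -> forall i, 0 <= dfwith x u i.
  by move=> x0 u0 i; case: dfwithP.
have fD (x : forall i, E i) j (u v : E j) :
    f (dfwith x (u + v)) = f (dfwith x u) + f (dfwith x v).
  by have := lf x j 1 u v; rewrite !scale1r.
have : positive_op f \/ positive_op (fun x => - f x).
  apply: contrapT => /not_orP[/existsNP[t /not_implyP[t0 /negP ft]]
    /existsNP[s /not_implyP[s0 /negP fs]]].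
  move: ft fs; rewrite oppr_ge0 -!ltNge => ft fs.
  pose P x := (forall i, 0 <= x i) /\ (f x : R) < 0.
  pose Q x := (forall i, 0 <= x i) /\ (0 : R) < f x.
  (* The common coordinate is x j + y j: the slice of f through x is nonpositive and the one through
     y nonnegative, so adding a positive vector keeps both strict signs. *)
  have step x y j : P x -> Q y ->
      exists w : E j, P (dfwith x w) /\ Q (dfwith y w).
    move=> [x0 fx] [y0 fy]; have w0 : 0 <= x j + y j by exact: riesz_addr_ge0.
    exists (x j + y j); split; split; try exact: dfwith_ge0; rewrite fD.
      rewrite dfwithE; case: (sign x j x0) => h.
        by have := h _ (x0 j); rewrite dfwithE leNgt fx.
      by apply: ltr_wnDr => //; exact: h.
    rewrite dfwithE; case: (sign y j y0) => h.
      by apply: ltr_wpDl => //; exact: h.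
    by have := h _ (y0 j); rewrite dfwithE leNgt fy.
  have [||w [[_ fw] [_ fw']]] := tuple_merge step.
  - by exists t.
  - by exists s.
  by have := lt_trans fw fw'; rewrite ltxx.
case=> f0; first exact: positive_regular.
exists (fun=> 0), (fun x => - f x); split=> //.
- by move=> x j a u v; rewrite scaler0 addr0.
- by move=> x j a u v; rewrite lf opprD scalerN.
- by move=> x; rewrite sub0r opprK.
Qed.

Lemma regular_op_comb (I : eqType) (E : I -> rieszType R) (a : R)
    (f g : (forall i, E i) -> R^o) :
  regular_op f -> regular_op g -> regular_op (fun x => a *: f x + g x).
Proof.
move=> [P [Q [lP P0 lQ Q0 fE]]] [P' [Q' [lP' P'0 lQ' Q'0 gE]]].
have lin (b : R) (p q : (forall i, E i) -> R^o) : multilinear p ->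
    multilinear q -> multilinear (fun x => b *: p x + q x).
  move=> lp lq x j c u v; rewrite lp lq !scalerDr !scalerA mulrC -!addrA.
  by congr (_ + _); rewrite addrCA.
have pos (b : R) (p q : (forall i, E i) -> R^o) : 0 <= b -> positive_op p ->
    positive_op q -> positive_op (fun x => b *: p x + q x).
  move=> b0 p0 q0 x x0; apply: riesz_addr_ge0; last exact: q0.
  by apply: riesz_scale_ge0 => //; exact: p0.
case: (leP 0 a) => a0.
  exists (fun x => a *: P x + P' x), (fun x => a *: Q x + Q' x).
  split; try by auto.
  by move=> x; rewrite fE gE scalerBr opprD addrACA.
have Na0 : 0 <= - a by rewrite oppr_ge0 ltW.
exists (fun x => - a *: Q x + P' x), (fun x => - a *: P x + Q' x).
split; try by auto.
move=> x; rewrite fE gE scalerBr !scaleNr opprD opprK [RHS]addrACA.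
by congr (_ + _); rewrite addrC.
Qed.

Lemma form_linear_sum (n : nat) (G : 'I_n -> rieszType R)
    (T : regmlin G R^o -> R^o) (k : nat) (c : 'I_k -> R)
    (C : 'I_k -> regmlin G R^o) (B : regmlin G R^o) :
  form_linear T -> (forall x, B x = \sum_i c i *: C i x) ->
  T B = \sum_i c i *: T (C i).
Proof.
move=> lT BE.
(* Linearity with coefficient 0 shows that T depends only on the values of the form. *)
have ext (B1 B2 : regmlin G R^o) : (forall x, B1 x = B2 x) -> T B1 = T B2.
  move=> e; rewrite (lT 0 B1 B2 B2) ?scale0r ?add0r// => x.
  by rewrite scale0r add0r.
have [D DE ->] : exists2 D : regmlin G R^o,
    forall x, D x = \sum_i c i *: C i x & \sum_i c i *: T (C i) = T D.
  elim: (index_enum _) => [|i r [D DE TD]].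
    have r0 : regular_op (fun _ : (forall i, G i) => 0 : R^o).
      apply: positive_regular => // x j a u v.
      by rewrite scaler0 addr0.
    exists (RegMlin r0) => [x|]; first by rewrite big_nil.
    rewrite big_nil.
    have := lT 1 (RegMlin r0) (RegMlin r0) (RegMlin r0).
    rewrite scale1r => /(_ _)/eqP; rewrite -subr_eq0 opprD addNKr.
    by rewrite oppr_eq0 => h; apply/esym/eqP/h => x /=; rewrite scaler0 addr0.
  exists (RegMlin (regular_op_comb (c i) (regmlinP (C i)) (regmlinP D))) => [x|].
    by rewrite big_cons /= DE.
  by rewrite big_cons TD; apply/esym/lT.
by apply: ext => x; rewrite BE DE.
Qed.

Lemma disjointness_preserving_perm (T : finType) (E : T -> rieszType R)
    (F : rieszType R) (rho : {perm T}) (A : regmlin E F) :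
  disjointness_preserving A -> disjointness_preserving (perm_regmlin rho A).
Proof. by move=> dA x j u v uv /=; rewrite !unpermute_with; exact: dA. Qed.

End RegularForms.

(** * Coordinates of an operator in a disjoint system *)

Section DisjointCoordinates.
Context {R : realType} {n : nat} {E : 'I_n -> rieszType R} {F : rieszType R}.
Variables (A : regmlin E F) (S : set F) (k : nat) (e : 'I_k -> F).
Variable a : (forall i, E i) -> 'I_k -> R.
Hypothesis archF : archimedean_riesz F.
Hypothesis se : disjoint_system S e.
Hypothesis AE : forall x, A x = \sum_i a x i *: e i.
Hypothesis dA : disjointness_preserving A.

(** The smaller of the two absolute coordinates, times e i, is below both disjoint images of A;
    hence it is 0. *)
Lemma coord_disjoint i x j (u v : E j) : disjoint_vec u v ->
  a (dfwith x u) i * a (dfwith x v) i = 0.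
Proof.
have [_ e0 en0 _] := se.
move=> /(dA x)/disjoint_vecP h.
have m0 : 0 <= Num.min `|a (dfwith x u) i| `|a (dfwith x v) i|.
  by rewrite le_min !normr_ge0.
have : Num.min `|a (dfwith x u) i| `|a (dfwith x v) i| *: e i <= 0.
  apply: h; rewrite AE; apply: le_trans (disjoint_system_coef_le _ i se);
    by apply: riesz_le_scaler; rewrite ?e0// ge_min lexx ?orbT.
move=> h0; have /eqP : Num.min `|a (dfwith x u) i| `|a (dfwith x v) i| *: e i = 0.
  by apply/eqP; rewrite eq_le h0 riesz_scale_ge0.
rewrite scaler_eq0 (negPf (en0 i)) orbF.
by case: leP => _ /eqP/normr0_eq0 ->; rewrite ?mul0r ?mulr0.
Qed.

(** Linearity in each variable comes from the linear independence of the system. *)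
Lemma coord_regular i : regular_op (fun x => a x i : R^o).
Proof.
have [_ e0 en0 _] := se.
apply: disjoint_multilinear_regular.
- move=> x j b u v; apply/eqP; rewrite -subr_eq0; apply/eqP.
  apply: (disjoint_system_free (c := fun i => a (dfwith x (b *: u + v)) i -
    (b * a (dfwith x u) i + a (dfwith x v) i)) i se).
  under eq_bigr do rewrite scalerBl scalerDl -scalerA.
  rewrite sumrB big_split /= -scaler_sumr -!AE.
  by rewrite (regmlin_multilinear A x b u v) subrr.
- by move=> x j u v; exact: coord_disjoint.
move=> x j w x0 w0; have [P [Q [lP P0 lQ Q0 APQ]]] := regmlinP A.
(* For 0 <= u <= w, |a_i| e i <= |A| <= P + Q at u, which is at most P + Q at w; the Archimedean
   property turns this into a bound on |a_i|. *)
have [M MP] := archimedean_bound archF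
  (P (dfwith x w) + Q (dfwith x w)) (e0 i) (en0 i).
exists M => u u0 uw; apply: MP.
rewrite (le_trans (disjoint_system_coef_le _ i se))// -AE APQ.
have mono (T : (forall i, E i) -> F) : multilinear T -> positive_op T ->
    0 <= T (dfwith x u) /\ T (dfwith x u) <= T (dfwith x w).
  move=> lT T0; split; first by apply: T0 => l; case: dfwithP.
  have -> : w = 1 *: (w - u) + u by rewrite scale1r subrK.
  rewrite lT scale1r -[leLHS]add0r riesz_leD// T0// => l.
  by case: dfwithP => //; rewrite riesz_subr_ge0.
have [Pu Pw] := mono P lP P0; have [Qu Qw] := mono Q lQ Q0.
have NP : - P (dfwith x u) <= 0 by rewrite -[leRHS]oppr0 riesz_le_opp2.
have NQ : - Q (dfwith x u) <= 0 by rewrite -[leRHS]oppr0 riesz_le_opp2.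
apply: rabs_le; rewrite ?opprB.
  by apply: riesz_leD => //; apply: (le_trans NQ); exact: le_trans Qu Qw.
rewrite [leLHS]addrC; apply: riesz_leD => //.
by apply: (le_trans NP); exact: le_trans Pu Pw.
Qed.


End DisjointCoordinates.


Theorem theorem5p3 (R : realType) (n : nat) (E : 'I_n.+1 -> rieszType R)
    (F : rieszType R) (A : regmlin E F) :
  archimedean_riesz F ->
  finite_lattice_rank A ->
  disjointness_preserving A ->
  forall rho : 'S_n.+1, disjointness_preserving (arens rho A).
Proof.
move=> archF finA dA rho x j u v uv.
have [k [e [se Se]]] :=
  finite_dim_disjoint_basis archF (smallest_sublattice (range A)) finA.
have coords t : exists c : 'I_k -> R, A t = \sum_i c i *: e i.
  by apply: Se; apply: sub_gen_smallest; exists t.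
have {coords} [a aE] := choice coords.
pose a_ i := RegMlin (coord_regular archF se aE dA i).
(* Composing A with y gives the combination of the coordinate forms with coefficients y (e i), and
   the Arens composite is linear in the form. *)
have arensE t : arens rho A t =
    \sum_i (arens_comp (fun l => t (rho l)) (perm_regmlin rho (a_ i)))
      *: bidual_eval (e i).
  apply: odual_eq => y.
  have -> : (\sum_i (arens_comp (fun l => t (rho l)) (perm_regmlin rho (a_ i)))
      *: bidual_eval (e i) : bidual F) y =
    \sum_i y (e i) *: arens_comp (fun l => t (rho l)) (perm_regmlin rho (a_ i)).
    elim/big_rec2: _ => // i s z _ IH.
    by rewrite odualD odualZ IH; congr (_ + _); exact: mulrC.
  apply: form_linear_sum; first exact: arens_comp_linear.
  move=> s /=; rewrite aE.
  elim/big_rec2: _ => [|i z w _ IH]; first exact: odual0.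
  rewrite odual_addr odual_scale IH; congr (_ + _); exact: mulrC.
have [_ e0 _ de] := se.
have [l jE] := perm_split rho j; subst j.
rewrite !arensE !permute_with.
apply: disjoint_suml => i _; apply: disjoint_vec_sym.
apply: disjoint_suml => i' _.
(* Terms of different index are disjoint through the e i; for equal indices one of the two real
   coefficients is 0. *)
have [<-|ii'] := eqVneq i i'; last first.
  by apply/disjointZZ/bidual_eval_disjoint => //; apply: de; rewrite eq_sym.
have da : disjointness_preserving (perm_regmlin rho (a_ i)).
  apply: disjointness_preserving_perm => s m p q pq; apply/disjoint_realE.
  exact: (coord_disjoint se aE dA).
have /eqP := arens_comp_disjoint (fun l => x (rho l)) da uv.
rewrite mulf_eq0 => /orP[] /eqP ->; rewrite scale0r; last exact: disjoint0v.
by apply/disjoint_vec_sym/disjoint0v.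
Qed.
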